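(* Let $F=|\overline{y}|\sqrt{\phi(z,r)}$ be a Finsler metric on $M=\mathbb{R}\times\mathbb{B}^n(\rho)$, where $z=\frac{y^0}{|\overline{y}|}$ and $r=|\overline{x}|$. Then $F$ is a Berwald metric if, and only if, $F$ is a Landsberg metric. In this case, either $F$ is Riemannian or $F$ is of the form $$F(x,y)=|\overline{y}|\,(h(r))^{-1}\,G\big(h(r)z\big),$$ where $h=h(r)$ and $G=G(t)$ are positive real functions such that $G-tG'>0$ and $G''>0$.
   Context: Let $n\ge 2$, let $\mathbb{B}^n(\rho)\subset\mathbb{R}^n$ be the open ball of radius $\rho$ centred at the origin, and $M=\mathbb{R}\times\mathbb{B}^n(\rho)$ (so $\dim M=n+1$), with coordinates $x=(x^0,\overline{x})$, $\overline{x}=(x^1,\dots,x^n)$ and tangent coordinates $y=(y^0,\overline{y})$, $\overline{y}=(y^1,\dots,y^n)$; $|\cdot|$ is the Euclidean norm on $\mathbb{R}^n$. Capital indices run over $0,\dots,n$. A Finsler metric on $M$ is a function $F:TM\to[0,\infty)$ that is $C^\infty$ on $TM\setminus\{0\}$ and restricts to a Minkowski norm on each tangent space. The metrics considered have the form $F=|\overline{y}|\sqrt{\phi(z,r)}$ with $\phi$ a differentiable function of $z$ and $r$; identities written in terms of $z$ and $r$ are read at points with $\overline{y}\neq0$, $\overline{x}\neq0$. With $g_{AB}=\frac12[F^2]_{y^Ay^B}$, the spray coefficients are $G^C=\frac14 g^{CA}\left([F^2]_{y^Ax^B}y^B-[F^2]_{x^A}\right)$ (sum over repeated indices). The Berwald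 tensor is $B^A_{BCD}=\frac{\partial^3G^A}{\partial y^B\partial y^C\partial y^D}$, and $F$ is a Berwald metric if $B^A_{BCD}=0$. The Landsberg tensor is $L_{ABC}=-\frac14[F^2]_{y^D}\,\frac{\partial^3G^D}{\partial y^A\partial y^B\partial y^C}$, and $F$ is a Landsberg metric if $L_{ABC}=0$. *)

(* Defs.v *)
From HB Require Import structures.
From mathcomp Require Import all_boot all_order all_algebra.
From mathcomp Require Import all_classical all_reals all_analysis.
Set Implicit Arguments.
Unset Strict Implicit.
Unset Printing Implicit Defensive.
Import Order.TTheory GRing.Theory Num.Theory.
Import numFieldNormedType.Exports.
Local Open Scope classical_set_scope.
Local Open Scope ring_scope.

Section Smooth.
Variables (R : realType) (V : normedModType R).

Fixpoint iter_derive (vs : seq V) (f : V -> R) : V -> R :=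
  if vs is v :: vs' then fun x => 'D_v (iter_derive vs' f) x else f.

(* C^oo on U, meant for U open: the iterated directional derivatives of all
   orders are Frechet differentiable, hence continuous, at every point of U. *)
Definition smooth_on (U : set V) (f : V -> R) : Prop :=
  forall (vs : seq V) (x : V), U x -> differentiable (iter_derive vs f) x.

End Smooth.

Section Coordinates.
Variables (R : realType) (n : nat).

Definition unit_vec (A : 'I_n.+1) : 'rV[R]_n.+1 := delta_mx 0 A.

Definition time_part (x : 'rV[R]_n.+1) : R := x 0 ord0.

Definition space_part (x : 'rV[R]_n.+1) : 'rV[R]_n :=
  \row_(i < n) x 0 (lift ord0 i).

(* The library norm on row vectors is the sup norm, which is used here only
   for the topology it induces. *)
Definition enorm (u : 'rV[R]_n) : R := Num.sqrt (\sum_(i < n) (u 0 i) ^+ 2).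

Definition cylinder (rho : R) : set 'rV[R]_n.+1 :=
  [set x | enorm (space_part x) < rho].

Definition slit_tangent (rho : R) : set ('rV[R]_n.+1 * 'rV[R]_n.+1) :=
  [set p | cylinder rho p.1 /\ p.2 != 0].

Definition quad_form (a : 'M[R]_n.+1) (v : 'rV[R]_n.+1) : R :=
  \sum_A \sum_B a A B * v 0 A * v 0 B.

Definition pos_def (a : 'M[R]_n.+1) : Prop :=
  forall v : 'rV[R]_n.+1, v != 0 -> 0 < quad_form a v.

End Coordinates.

Section Finsler.
Variables (R : realType) (n : nat).
Local Notation E := 'rV[R]_n.+1.

(* g_AB = (1/2) [N^2]_{y^A y^B} *)
Definition fundamental_tensor (N : E -> R) (y : E) : 'M[R]_n.+1 :=
  \matrix_(A, B) (2^-1 *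
    'D_(unit_vec R B) (fun u => 'D_(unit_vec R A) (fun w => N w ^+ 2) u) y).

(* Positivity off the origin and N 0 = 0 follow from these axioms. *)
Definition minkowski_norm (N : E -> R) : Prop :=
  [/\ forall y, 0 <= N y,
      smooth_on [set y : E | y != 0] N,
      forall (c : R) (y : E), 0 < c -> N (c *: y) = c * N y &
      forall y, y != 0 -> pos_def (fundamental_tensor N y)].

Definition finsler_metric (rho : R) (F : E -> E -> R) : Prop :=
  smooth_on (slit_tangent rho) (fun p : E * E => F p.1 p.2) /\
  forall x, cylinder rho x -> minkowski_norm (F x).

Definition d_x (A : 'I_n.+1) (f : E -> E -> R) : E -> E -> R :=
  fun x y => 'D_(unit_vec R A) (fun x' => f x' y) x.

Definition d_y (A : 'I_n.+1) (f : E -> E -> R) : E -> E -> R :=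
  fun x y => 'D_(unit_vec R A) (f x) y.

Definition energy (F : E -> E -> R) : E -> E -> R := fun x y => F x y ^+ 2.

Definition spray (F : E -> E -> R) (C : 'I_n.+1) : E -> E -> R :=
  fun x y => 4^-1 * \sum_A invmx (fundamental_tensor (F x) y) C A *
    (\sum_B d_x B (d_y A (energy F)) x y * y 0 B - d_x A (energy F) x y).

Definition berwald_tensor (F : E -> E -> R) (A B C D : 'I_n.+1) :
    E -> E -> R :=
  d_y D (d_y C (d_y B (spray F A))).

Definition landsberg_tensor (F : E -> E -> R) (A B C : 'I_n.+1) :
    E -> E -> R :=
  fun x y => - 4^-1 * \sum_D d_y D (energy F) x y *
    d_y C (d_y B (d_y A (spray F D))) x y.

Definition is_berwald (rho : R) (F : E -> E -> R) : Prop :=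
  forall x y, slit_tangent rho (x, y) ->
  forall A B C D, berwald_tensor F A B C D x y = 0.

Definition is_landsberg (rho : R) (F : E -> E -> R) : Prop :=
  forall x y, slit_tangent rho (x, y) ->
  forall A B C, landsberg_tensor F A B C x y = 0.

Definition is_riemannian (rho : R) (F : E -> E -> R) : Prop :=
  exists a : E -> 'M[R]_n.+1,
    (forall A B, smooth_on (cylinder rho) (fun x => a x A B)) /\
    forall x, cylinder rho x ->
      [/\ (a x)^T = a x, pos_def (a x) &
          forall y, F x y = Num.sqrt (quad_form (a x) y)].

End Finsler.

(* Main.v *)
Require Import Defs.
From HB Require Import structures.
From mathcomp Require Import all_boot all_order all_algebra.
From mathcomp Require Import all_classical all_reals all_analysis.
From mathcomp Require Import ring lra.
Set Implicit Arguments.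
Unset Strict Implicit.
Unset Printing Implicit Defensive.
Import Order.TTheory GRing.Theory Num.Theory.
Import numFieldNormedType.Exports.
Local Open Scope classical_set_scope.
Local Open Scope ring_scope.

(** Write [E = F ^+ 2], [a = y^0], [b] for the norm of the spatial part of [y],
    [z = a / b] for the slope and [r] for the norm of the spatial part of [x].
    The hypothesis says that [E = b ^+ 2 * p z], where the profile [p] depends
    on [r] only. Let [q] be the derivative of [p] in [r], let primes denote
    derivatives in [z], and put [M = 2 * p - z * p'].

    The rotational symmetry allows the geodesic equations to be solved in
    closed form ([spray_formula]): with [s] the derivative of [r] along [y],
    the time component of the spray is [s * b * u z], and its spatial component
    is [s * v z] times that of [y] plus a multiple of that of [x]. The rates
    [u] and [v] satisfy [q = M * v + p' * u] ([rates]): moving [(a, b)] with the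
    velocity [(b * u, b * v)] accounts for the change of the norm with the
    radius. The metric is of Berwald type when this velocity is linear.

    A Berwald metric is trivially a Landsberg metric. Conversely, the Landsberg
    tensor is evaluated at a [y] orthogonal to [x] on the direction of [x] taken
    three times. This gives [p' * (u - z * u') = M * z * v'] ([landsberg_rates]),
    which with the formulas for [u] and [v] becomes
    [u * (p' - z * p'') = 0] ([landsberg_profile]). Now [p' = z * p''] holds for
    all [z] exactly when [p] is a quadratic polynomial without linear term, that
    is, for a Euclidean norm. Where [u] does not vanish, [p' = z * p''] holds in
    a neighbourhood, both for the nearby slopes and for the nearby radii; its
    two derivatives yield [u = z * u'] ([time_rate_homogeneous]). Hence [u] is
    [l * z] on the whole line for some [l] depending on [r]
    ([homogeneous_line]), [v] is constant in [z], and [l] vanishes unless [p] is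
    quadratic ([landsberg_linear]). So the spray is quadratic in [y] wherever
    the spatial parts of [x] and [y] are non-zero ([spray_quadratic]). The
    Berwald tensor vanishes there, and by continuity on the whole slit tangent
    bundle ([slit_density]).

    For the classification, [q = v * M + l * z * p'] says that the norms at
    different radii are carried to one another by diagonal linear maps of the
    [(a, b)] plane. The two diagonal entries are determined by [p 0] and
    [p'' 0], and the profiles rescaled by them coincide ([profile_similar]). If
    [l] is non-zero at some radius, the norm there is Euclidean, hence so it is
    at every radius, and [F] is Riemannian. If [l] is zero at every radius, then
    [p'' 0] does not depend on [r], only [b] is rescaled, and this is the second
    form, with [h ^+ 2 = p'' 0 / p 0]. *)

(** * Directional derivatives *)

Section Directional.
Variable R : realType.
Implicit Types V W : normedModType R.

(** Lines, slices and other affine curves all satisfy the hypothesis on [A],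
    which reduces a directional derivative of [f] to one of lower dimension. *)
Lemma is_derive_affine V W (A : W -> V) (f : V -> R) (x w : W) (v : V) (d : R) :
  (forall h : R, A (h *: w + x) = h *: v + A x) ->
  is_derive (A x) v f d -> is_derive x w (fun t => f (A t)) d.
Proof.
move=> hA.
have e : (fun h : R => h^-1 *: (((fun t => f (A t)) \o shift x) (h *: w) - f (A x)))
  = (fun h : R => h^-1 *: ((f \o shift (A x)) (h *: v) - f (A x))).
  by apply/funext => h /=; rewrite hA.
move=> [h1 h2]; split; first by rewrite /derivable e.
by rewrite -h2 /derive e.
Qed.

Lemma derive_affine V W (A : W -> V) (f : V -> R) (x w : W) (v : V) :
  (forall h : R, A (h *: w + x) = h *: v + A x) ->
  'D_w (fun t => f (A t)) x = 'D_v f (A x).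
Proof.
move=> hA; rewrite /derive.
suff -> : (fun h : R => h^-1 *: (((fun t => f (A t)) \o shift x) (h *: w) - f (A x)))
  = (fun h : R => h^-1 *: ((f \o shift (A x)) (h *: v) - f (A x))) by [].
by apply/funext => h /=; rewrite hA.
Qed.

(** Only a directional derivative of the inner function is available in
    applications, so the chain rule is reduced to that of one real variable by
    restricting to the line through [x]. *)
Lemma is_derive_chain V (g : V -> R) (u : R -> R) (x v : V) (dg du : R) :
  is_derive x v g dg -> is_derive (g x) 1 u du ->
  is_derive x v (fun t => u (g t)) (du * dg).
Proof.
move=> [hg <-] hu.
have hl : is_derive (0 : R) 1 (fun h : R => g (h *: v + x)) ('D_v g x).
  apply: (@is_derive_affine V R (fun h : R => h *: v + x) g (0 : R) 1 v).
    by move=> h /=; rewrite addr0 scale0r add0r [_%:A]mulr1.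
  by rewrite scale0r add0r; split.
have hc : is_derive (0 : R) 1 (fun h : R => u (g (h *: v + x))) (du * 'D_v g x).
  apply: (@is_derive1_comp R u (fun h : R => g (h *: v + x))) => //.
  by rewrite scale0r add0r.
have e : (fun h : R => h^-1 *: (((fun t => u (g t)) \o shift x) (h *: v) - u (g x)))
  = (fun h : R => h^-1 *: (((fun h : R => u (g (h *: v + x))) \o shift 0)
      (h *: (1 : R)) - u (g ((0 : R) *: v + x)))).
  by apply/funext => h /=; rewrite addr0 scale0r add0r [_%:A]mulr1.
case: hc => h1 h2; split; first by rewrite /derivable e.
by rewrite -h2 /derive e.
Qed.

Lemma derive_scale V (f : V -> R) (x v : V) (c : R) :
  differentiable f x -> 'D_(c *: v) f x = c * 'D_v f x.
Proof. by move=> df; rewrite !deriveE// linearZ. Qed.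

Lemma near_eq_open V (U : set V) (f g : V -> R) (x : V) :
  open U -> U x -> (forall y, U y -> f y = g y) -> \near x, f x = g x.
Proof. by move=> oU Ux fg; apply: filterS (open_nbhs_nbhs (conj oU Ux)). Qed.

Lemma derive_eq_open V (U : set V) (f g : V -> R) (x v : V) :
  open U -> U x -> (forall y, U y -> f y = g y) -> 'D_v f x = 'D_v g x.
Proof. by move=> oU Ux fg; apply: near_eq_derive; exact: near_eq_open fg. Qed.

Lemma is_derive_eq_open V (U : set V) (f g : V -> R) (x v : V) (d : R) :
  open U -> U x -> (forall y, U y -> f y = g y) ->
  is_derive x v f d -> is_derive x v g d.
Proof.
by move=> oU Ux fg; apply: near_eq_is_derive; exact: near_eq_open fg.
Qed.

(** The difference of the two functions vanishes near [x], hence is negligible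
    there with derivative 0. *)
Lemma differentiable_eq_open V (U : set V) (f g : V -> R) (x : V) :
  open U -> U x -> (forall y, U y -> f y = g y) ->
  differentiable f x -> differentiable g x.
Proof.
move=> oU Ux fg df.
pose h : V -> R := g - f.
suff dh : differentiable h x.
  have -> : g = f + h by rewrite /h addrC subrK.
  exact: differentiableD.
have hE y : h y = g y - f y by [].
have hx : h x = 0 by rewrite hE fg// subrr.
have ho : h \o shift x = cst (h x) + (\0 : {linear V -> R}) +o_ (0 : V) id.
  rewrite hx; apply/eqaddoP => _/posnumP[e].
  have nU : nbhs x U := open_nbhs_nbhs (conj oU Ux).
  have tU : \forall t \near (0 : V), U (t + x).
    rewrite (near_shift x) sub0r; near=> y; rewrite /= subrK.
    by near: y.
  apply: filterS tU => t Utx.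
  by rewrite !fctE /= hE fg// !subrr addr0 subrr normr0 mulr_ge0.
have hc : continuous (\0 : {linear V -> R}) by move=> y; exact: cst_continuous.
have e := diff_unique hc ho.
by apply/diff_locallyP; rewrite e.
Unshelve. all: by end_near. Qed.

(** The rules of the calculus for functions written pointwise with values in
    [R], where scaling is multiplication. *)
Section Rules.
Variables (V : normedModType R) (x v : V) (f g : V -> R) (a b : R).
Hypotheses (fa : is_derive x v f a) (gb : is_derive x v g b).

Lemma is_derive_addf : is_derive x v (fun t => f t + g t) (a + b).
Proof. exact: is_deriveD. Qed.

Lemma is_derive_subf : is_derive x v (fun t => f t - g t) (a - b).
Proof. exact: is_deriveB. Qed.

Lemma is_derive_mulf : is_derive x v (fun t => f t * g t) (f x * b + g x * a).
Proof. exact: is_deriveM. Qed.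

Lemma is_derive_cmulf (c : R) : is_derive x v (fun t => c * f t) (c * a).
Proof. exact: (is_deriveZ c). Qed.

Lemma is_derive_expf n : is_derive x v (fun t => f t ^+ n.+1) (n.+1%:R * f x ^+ n * a).
Proof.
have -> : (fun t => f t ^+ n.+1) = (f : V -> R^o) ^+ n.+1 by rewrite exprfctE.
exact: is_deriveX.
Qed.

Lemma is_derive_invf : f x != 0 ->
  is_derive x v (fun t => (f t)^-1) (- ((f x) ^- 2 * a)).
Proof.
move=> f0; case: fa => df da; split; first exact: derivableV.
by rewrite deriveV// da scaleNr.
Qed.

Lemma is_derive_divf : g x != 0 ->
  is_derive x v (fun t => f t / g t) ((a * g x - f x * b) / g x ^+ 2).
Proof.
move=> g0; case: fa => df da; case: gb => dg db.
have dV : is_derive x v (fun t => (g t)^-1) (- ((g x) ^- 2 * b)).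
  by split; [exact: derivableV|rewrite deriveV// db scaleNr].
have : is_derive x v (fun t => f t * (g t)^-1) (f x * - ((g x) ^- 2 * b) + (g x)^-1 * a).
  exact: is_deriveM.
by move=> h; apply: (is_derive_eq h); field.
Qed.

End Rules.

Lemma is_derive_cstf V (x v : V) (c : R) : is_derive x v (fun=> c) 0.
Proof. exact: is_derive_cst. Qed.

Lemma is_derive_sumf V n (x v : V) (h : 'I_n -> V -> R) (d : 'I_n -> R) :
  (forall i, is_derive x v (h i) (d i)) ->
  is_derive x v (fun t => \sum_(i < n) h i t) (\sum_(i < n) d i).
Proof.
move=> hd; rewrite (_ : (fun t => _) = \sum_(i < n) h i); last first.
  by apply/funext => t; rewrite fct_sumE.
exact: is_derive_sum.
Qed.

End Directional.

Lemma is_derive_idR (R : realType) (t : R) : is_derive t (1 : R) (fun t : R => t) 1.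
Proof. exact: is_derive_id. Qed.

(** * Functions of class C^k *)

(** All derivatives of order at most [k] are differentiable, which is one order
    more than the classical C^k. The recursion differentiates [f] first, so that
    closure properties follow by induction on [k] from the rules of calculus;
    [smooth_on], which differentiates last, is the conjunction over [k]. *)
Fixpoint Ck (R : realType) (V : normedModType R) (k : nat) (U : set V)
    (f : V -> R) : Prop :=
  (forall x, U x -> differentiable f x) /\
  (if k is k'.+1 then forall v, Ck k' U (fun x => 'D_v f x) else True).

Section CkTheory.
Variables (R : realType) (V : normedModType R) (U : set V).
Hypothesis oU : open U.
Implicit Types (f g : V -> R) (k : nat).

Lemma Ck_differentiable k f x : Ck k U f -> U x -> differentiable f x.
Proof. by case: k => [|k] [df _] Ux; exact: df. Qed.

Lemma Ck_derive k f v : Ck k.+1 U f -> Ck k U (fun x => 'D_v f x).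
Proof. by move=> [_]; exact. Qed.

Lemma Ck_is_derive k f x v : Ck k U f -> U x -> is_derive x v f ('D_v f x).
Proof.
by move=> cf Ux; apply: derivableP; apply: diff_derivable;
  exact: Ck_differentiable cf Ux.
Qed.

Lemma Ck_continuous k f x : Ck k U f -> U x -> {for x, continuous f}.
Proof. by move=> cf Ux; apply: differentiable_continuous; exact: Ck_differentiable cf Ux. Qed.

Lemma eq_Ck k f g : (forall x, U x -> f x = g x) -> Ck k U f -> Ck k U g.
Proof.
elim: k f g => [|k IH] f g fg [df hf]; split=> //.
- by move=> x Ux; exact: (differentiable_eq_open oU Ux fg (df x Ux)).
- by move=> x Ux; exact: (differentiable_eq_open oU Ux fg (df x Ux)).
- by move=> v; apply: IH (hf v) => x Ux; exact: (derive_eq_open v oU Ux fg).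
Qed.

Lemma CkW k f : Ck k.+1 U f -> Ck k U f.
Proof.
by elim: k f => [|k IH] f [df hf]; split=> // v; apply: IH; exact: hf.
Qed.

Lemma Ck_cst k (c : R) : Ck k U (fun=> c).
Proof.
elim: k c => [|k IH] c; split=> //; try by move=> x _; exact: differentiable_cst.
by move=> v; apply: eq_Ck (IH 0) => x _; rewrite derive_cst.
Qed.

Lemma CkD k f g : Ck k U f -> Ck k U g -> Ck k U (fun x => f x + g x).
Proof.
elim: k f g => [|k IH] f g [df hf] [dg hg]; split=> //;
  try by move=> x Ux; apply: differentiableD; [exact: df|exact: dg].
move=> v; apply: eq_Ck (IH _ _ (hf v) (hg v)) => x Ux.
by rewrite deriveD//; apply: diff_derivable; [exact: df|exact: dg].
Qed.

Lemma CkM k f g : Ck k U f -> Ck k U g -> Ck k U (fun x => f x * g x).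
Proof.
elim: k f g => [|k IH] f g cf cg; move: (cf) (cg) => [df hf] [dg hg]; split=> //;
  try by move=> x Ux; apply: differentiableM; [exact: df|exact: dg].
move=> v; apply: eq_Ck (CkD (IH _ _ (CkW cf) (hg v)) (IH _ _ (CkW cg) (hf v))).
move=> x Ux; rewrite -[fun x => f x * g x]/(f * g).
by rewrite deriveM//; apply: diff_derivable; [exact: df|exact: dg].
Qed.

Lemma CkN k f : Ck k U f -> Ck k U (fun x => - f x).
Proof.
move=> cf; apply: eq_Ck (CkM (Ck_cst k (-1)) cf) => x _.
by rewrite mulN1r.
Qed.

Lemma CkB k f g : Ck k U f -> Ck k U g -> Ck k U (fun x => f x - g x).
Proof. by move=> cf cg; apply: CkD cf (CkN cg). Qed.

Lemma CkX k f n : Ck k U f -> Ck k U (fun x => f x ^+ n).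
Proof.
move=> cf; elim: n => [|n IH].
  by apply: eq_Ck (Ck_cst k 1) => x _; rewrite expr0.
by apply: eq_Ck (CkM cf IH) => x _; rewrite exprS.
Qed.

Lemma Ck_sum k (I : Type) (s : seq I) (P : pred I) (F : I -> V -> R) :
  (forall i, P i -> Ck k U (F i)) -> Ck k U (fun x => \sum_(i <- s | P i) F i x).
Proof.
move=> cF; elim: s => [|i s IH].
  by apply: eq_Ck (Ck_cst k 0) => x _; rewrite big_nil.
case Pi: (P i); last by apply: eq_Ck IH => x _; rewrite big_cons Pi.
by apply: eq_Ck (CkD (cF i Pi) IH) => x _; rewrite big_cons Pi.
Qed.

Lemma Ck_prod k (I : Type) (s : seq I) (P : pred I) (F : I -> V -> R) :
  (forall i, P i -> Ck k U (F i)) -> Ck k U (fun x => \prod_(i <- s | P i) F i x).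
Proof.
move=> cF; elim: s => [|i s IH].
  by apply: eq_Ck (Ck_cst k 1) => x _; rewrite big_nil.
case Pi: (P i); last by apply: eq_Ck IH => x _; rewrite big_cons Pi.
by apply: eq_Ck (CkM (cF i Pi) IH) => x _; rewrite big_cons Pi.
Qed.

Lemma CkV k f : (forall x, U x -> f x != 0) -> Ck k U f ->
  Ck k U (fun x => (f x)^-1).
Proof.
move=> f0; elim: k => [|k IH] cf; move: (cf) => [df hf]; split=> //;
  try by move=> x Ux; apply: differentiableV; [exact: df|exact: f0].
move=> v; have ci := IH (CkW cf).
apply: eq_Ck (CkN (CkM (CkX 2 ci) (hf v))) => x Ux.
rewrite deriveV ?f0//; last by apply: diff_derivable; exact: df.
by rewrite exprVn scaleNr.
Qed.

Lemma Ck_det k n (A : 'I_n -> 'I_n -> V -> R) :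
  (forall i j, Ck k U (A i j)) ->
  Ck k U (fun x => \det (\matrix_(i, j) A i j x)).
Proof.
move=> cA; rewrite /determinant.
apply: Ck_sum => s _; apply: CkM; first exact: Ck_cst.
apply: Ck_prod => i _; apply: eq_Ck (cA i (perm.fun_of_perm s i)) => x _.
by rewrite mxE.
Qed.

(** Cramer's rule: each entry of the inverse is a cofactor over the
    determinant. *)
Lemma Ck_invmx k n (A : 'I_n -> 'I_n -> V -> R) :
  (forall x, U x -> (\matrix_(i, j) A i j x) \in unitmx) ->
  (forall i j, Ck k U (A i j)) ->
  forall i j, Ck k U (fun x => invmx (\matrix_(i, j) A i j x) i j).
Proof.
move=> uA cA i j.
have d0 x : U x -> \det (\matrix_(i, j) A i j x) != 0.
  by move=> Ux; move: (uA x Ux); rewrite unitmxE unitfE.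
have cC : Ck k U (fun x => cofactor (\matrix_(i, j) A i j x) j i).
  rewrite /cofactor; apply: CkM; first exact: Ck_cst.
  apply: (@eq_Ck k (fun x => \det (\matrix_(a, b) A (lift j a) (lift i b) x))).
    by move=> x _; congr (\det _); apply/matrixP => a b; rewrite !mxE.
  by apply: Ck_det.
apply: eq_Ck (CkM (CkV d0 (Ck_det cA)) cC) => x Ux.
by rewrite /invmx uA// !mxE.
Qed.

Lemma smooth_onP f : smooth_on U f <-> forall k, Ck k U f.
Proof.
split.
  move=> sf k; elim: k f sf => [|k IH] f sf; split=> //.
  - by move=> x Ux; exact: (sf [::] x Ux).
  - by move=> x Ux; exact: (sf [::] x Ux).
  move=> v; apply: IH => vs x Ux.
  suff <- : iter_derive (rcons vs v) f = iter_derive vs (fun x => 'D_v f x).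
    exact: sf.
  by elim: vs => //= w vs ->.
move=> cf vs x Ux.
suff : forall k, Ck k U (iter_derive vs f).
  by move=> /(_ 0%N)/Ck_differentiable; exact.
by elim: vs => //= v vs IH k; apply: Ck_derive; exact: IH.
Qed.

End CkTheory.

Section CkComposition.
Variables (R : realType) (V W : normedModType R).

Lemma Ck_affine k (U : set V) (D : set W) (A : W -> V) (L : W -> V) (f : V -> R) :
  open U -> open D -> (forall x, differentiable A x) ->
  (forall (h : R) w x, A (h *: w + x) = h *: L w + A x) ->
  (forall x, D x -> U (A x)) -> Ck k U f -> Ck k D (fun x => f (A x)).
Proof.
move=> oU oD dA AL DU; elim: k f => [|k IH] f [df hf]; split=> //;
  try by move=> x Dx; apply: (@differentiable_comp _ _ _ _ A f);
    [exact: dA|apply: df; exact: DU].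
move=> w; apply: (eq_Ck oD _ (IH _ (hf (L w)))) => x Dx.
by rewrite (@derive_affine _ _ _ A f x w (L w)).
Qed.

Lemma Ck_comp k (U : set V) (D : set R) (g : V -> R) (u : R -> R) :
  open U -> open D -> (forall x, U x -> D (g x)) ->
  Ck k D u -> Ck k U g -> Ck k U (fun x => u (g x)).
Proof.
move=> oU oD UD; elim: k u => [|k IH] u cu cg; move: (cu) (cg) => [du hu] [dg hg];
  split=> //; try by move=> x Ux; apply: (@differentiable_comp _ _ _ _ g u);
    [exact: dg|apply: du; exact: UD].
move=> v; apply: (eq_Ck oU _ (CkM oU (IH _ (hu 1) (CkW cg)) (hg v))) => x Ux.
apply/esym/derive_val; apply: is_derive_chain.
  by apply: derivableP; apply: diff_derivable; exact: dg.
by apply: derivableP; apply: diff_derivable; apply: du; exact: UD.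
Qed.

End CkComposition.

(** * Mean value arguments *)

Section MeanValue.
Variable R : realType.

Lemma mean_value0 (f df : R -> R) (h : R) : 0 < h ->
  (forall s, 0 <= s -> s <= h -> is_derive s 1 f (df s)) ->
  exists c, [/\ 0 <= c, c <= h & f h - f 0 = h * df c].
Proof.
move=> h0 fdf.
have [||c c0h e] := @MVT_segment R f df 0 h (ltW h0).
- by move=> x; rewrite in_itv /= => /andP[/ltW ? /ltW ?]; exact: fdf.
- apply: derivable_within_continuous => x; rewrite in_itv /= => /andP[x0 xh].
  by have [] := fdf x x0 xh.
- move: c0h; rewrite in_itv /= => /andP[c0 ch].
  by exists c; split=> //; rewrite e subr0 mulrC.
Qed.

Lemma derive0_cst (D : set R) (f : R -> R) :
  (forall x y z, D x -> D y -> x <= z -> z <= y -> D z) ->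
  (forall x, D x -> is_derive x 1 f 0) ->
  forall x y, D x -> D y -> f x = f y.
Proof.
move=> cD f0.
suff H x y : x <= y -> D x -> D y -> f x = f y.
  by move=> x y Dx Dy; case: (leP x y) => [/H|/ltW/H H']; [exact|rewrite H'].
move=> xy Dx Dy.
have [||c _] := @MVT_segment R f (fun=> 0) x y xy.
- by move=> z; rewrite in_itv /= => /andP[/ltW xz /ltW zy]; apply: f0; exact: cD xz zy.
- apply: derivable_within_continuous => z; rewrite in_itv /= => /andP[xz zy].
  by have [] := f0 z (cD _ _ _ Dx Dy xz zy).
- by rewrite mul0r => /eqP; rewrite subr_eq0 => /eqP ->.
Qed.

Lemma continuous_near (V : normedModType R) (f : V -> R) (x : V) (e : R) :
  {for x, continuous f} -> 0 < e -> nbhs x [set y | `|f x - f y| < e].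
Proof. by move=> /cvgrPdist_lt cf e0; exact: cf. Qed.

(** The mean value theorem is used in each direction in turn. The second
    difference is symmetric in [v] and [w], so exchanging them expresses it by
    the other mixed derivative. *)
Lemma second_difference (V : normedModType R) (U : set V) (f : V -> R)
    (x v w : V) (h : R) :
  0 < h -> Ck 1 U f ->
  (forall a b, 0 <= a -> a <= h -> 0 <= b -> b <= h -> U (x + a *: v + b *: w)) ->
  exists a b, [/\ 0 <= a, a <= h, 0 <= b & b <= h] /\
    f (x + h *: v + h *: w) - f (x + h *: v) - f (x + h *: w) + f x =
    h * (h * 'D_w (fun y => 'D_v f y) (x + a *: v + b *: w)).
Proof.
move=> h0 cf Uh.
have sline (s b : R) : is_derive s (1 : R) (fun s : R => f (x + s *: v + b *: w))
    ('D_v f (x + s *: v + b *: w)) \/ ~ U (x + s *: v + b *: w).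
  case: (pselect (U (x + s *: v + b *: w))) => [Us|]; [left|by right].
  apply: (@is_derive_affine R V R (fun s : R => x + s *: v + b *: w) f s (1 : R) v).
    by move=> k; rewrite [k%:A]mulr1 scalerDl; rewrite -!addrA addrCA.
  exact: Ck_is_derive cf Us.
have h0' := ltW h0.
have [|a [a0 ah ea]] := @mean_value0
    (fun s => f (x + s *: v + h *: w) - f (x + s *: v + 0 *: w))
    (fun s => 'D_v f (x + s *: v + h *: w) - 'D_v f (x + s *: v + 0 *: w)) h h0.
  move=> s s0 sh; apply: is_deriveB.
    by have [|] := sline s h => // /(_ (Uh _ _ s0 sh h0' (lexx h))).
  by have [|] := sline s 0 => // /(_ (Uh _ _ s0 sh (lexx 0) h0')).
have [|b [b0 bh eb]] := @mean_value0
    (fun t => 'D_v f (x + a *: v + t *: w))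
    (fun t => 'D_w (fun y => 'D_v f y) (x + a *: v + t *: w)) h h0.
  move=> t t0 th.
  apply: (@is_derive_affine R V R (fun t : R => x + a *: v + t *: w)
    (fun y => 'D_v f y) t (1 : R) w).
    by move=> k; rewrite [k%:A]mulr1 scalerDl addrCA.
  by apply: (Ck_is_derive w (Ck_derive v cf)); exact: Uh.
exists a, b; split=> //.
rewrite -eb -ea !scale0r !addr0; ring.
Qed.

Lemma continuous_eq_nearby (V : normedModType R) (A B : V -> R) (x : V) :
  {for x, continuous A} -> {for x, continuous B} ->
  (forall d : R, 0 < d -> exists p q, [/\ ball x d p, ball x d q & A p = B q]) ->
  A x = B x.
Proof.
move=> cA cB hAB; apply/eqP; rewrite -subr_eq0 -normr_eq0 -[_ == _]negbK.
apply/negP => AB.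
have e0 : 0 < `|A x - B x| / 2 by rewrite divr_gt0// lt_def AB normr_ge0.
have nAB : nbhs x ([set y | `|A x - A y| < `|A x - B x| / 2]
    `&` [set y | `|B x - B y| < `|A x - B x| / 2]).
  by apply: filterI; exact: continuous_near.
move/nbhs_ballP: nAB => [d /= d0 dN].
have [p [q [/dN[/= hA _] /dN[/= _ hB] pq]]] := hAB d d0.
suff : `|A x - B x| < `|A x - B x| by rewrite ltxx.
rewrite [ltRHS]splitr; apply: le_lt_trans (ltrD hA hB).
rewrite -pq [X in _ <= _ + X]distrC; apply: le_trans (ler_normD _ _).
by rewrite addrA subrK.
Qed.

(** Symmetry of second derivatives: both mixed derivatives are limits of the
    same second difference quotients. *)
Lemma derive_swap (V : normedModType R) (U : set V) (f : V -> R) (x v w : V) :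
  open U -> U x -> Ck 2 U f ->
  'D_w (fun y => 'D_v f y) x = 'D_v (fun y => 'D_w f y) x.
Proof.
move=> oU Ux cf.
apply: (@continuous_eq_nearby _ (fun z => 'D_w (fun y => 'D_v f y) z)
  (fun z => 'D_v (fun y => 'D_w f y) z)).
- by apply: (Ck_continuous (k := 0) (U := U)) => //; do 2!apply: Ck_derive.
- by apply: (Ck_continuous (k := 0) (U := U)) => //; do 2!apply: Ck_derive.
move=> d' d'0.
have nU : nbhs x U := open_nbhs_nbhs (conj oU Ux).
have nUd : nbhs x (U `&` ball x d') by apply: filterI => //; exact: nbhsx_ballx.
move/nbhs_ballP: nUd => [d /= d0 dN].
pose h := d / (2 * (`|v| + `|w| + 1)).
have s0 : 0 < `|v| + `|w| + 1 by rewrite ltr_wpDl ?addr_ge0.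
have h0 : 0 < h by rewrite divr_gt0// mulr_gt0.
have small a b : 0 <= a -> a <= h -> 0 <= b -> b <= h ->
    ball x d (x + a *: v + b *: w).
  move=> a0 ah b0 bh; rewrite -ball_normE /= -addrA opprD addNKr normrN.
  apply: (@le_lt_trans _ _ (h * (`|v| + `|w| + 1))).
    rewrite (le_trans (ler_normD _ _))// !normrZ !ger0_norm// 2!mulrDr.
    by rewrite -addrA lerD ?ler_wpM2r// ler_wpDr// ?ler_wpM2r// mulr_ge0// ltW.
  by rewrite /h invfM mulrA divfK ?gt_eqF// gtr_pMr// invf_lt1// ltr1n.
have [|a [b [[a0 ah b0 bh] eA]]] := @second_difference V U f x v w h h0 (CkW cf).
  by move=> a b a0 ah b0 bh; have [] := dN _ (small a b a0 ah b0 bh).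
have [|b' [a' [[b0' bh' a0' ah'] eB]]] := @second_difference V U f x w v h h0 (CkW cf).
  by move=> b' a' *; rewrite addrAC; have [] := dN _ (small a' b' _ _ _ _).
exists (x + a *: v + b *: w), (x + b' *: w + a' *: v); split.
- by have [] := dN _ (small a b a0 ah b0 bh).
- by rewrite addrAC; have [] := dN _ (small a' b' a0' ah' b0' bh').
apply: (mulfI (lt0r_neq0 h0)); apply: (mulfI (lt0r_neq0 h0)).
apply: etrans (esym eA) _; apply: etrans eB; rewrite (addrAC x (h *: w)).
by congr (_ + _); exact: addrAC.
Qed.

(** [t * g (1 + t ^+ 2)] is odd, and its expansion at 0 is
    [g 1 * t + g' 1 * t ^+ 3 + ...]. *)
Lemma third_derivative_odd (g f : R -> R) :
  Ck 2 [set s : R | 0 < s] g -> (forall t, f t = t * g (1 + t ^+ 2)) ->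
  'D_1 (fun t => 'D_1 (fun t => 'D_1 f t) t) (0 : R) = 6 * 'D_1 g (1 : R).
Proof.
move=> cg fE.
have pos (t : R) : 0 < 1 + t ^+ 2 by rewrite ltr_wpDr// sqr_ge0.
pose g1 := fun s : R => 'D_1 g s; pose g2 := fun s : R => 'D_1 g1 s.
have dg (s : R) : 0 < s -> is_derive s (1 : R) g (g1 s).
  by move=> s0; exact: (Ck_is_derive (1 : R) cg s0).
have dg1 (s : R) : 0 < s -> is_derive s (1 : R) g1 (g2 s).
  by move=> s0; exact: (Ck_is_derive (1 : R) (Ck_derive (1 : R) cg) s0).
have dg2 (s : R) : 0 < s -> is_derive s (1 : R) g2 ('D_1 g2 s).
  by move=> s0; exact: (Ck_is_derive (1 : R) (Ck_derive (1 : R) (Ck_derive (1 : R) cg)) s0).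
have dq (t : R) : is_derive t (1 : R) (fun t : R => 1 + t ^+ 2) (2 * t).
  apply: (is_derive_eq (is_derive_addf (is_derive_cstf t (1 : R) 1)
    (is_derive_expf (is_derive_idR t) 1))).
  by rewrite add0r expr1 mulr1.
have dc (k dk : R -> R) t : (forall s : R, 0 < s -> is_derive s (1 : R) k (dk s)) ->
    is_derive t (1 : R) (fun t : R => k (1 + t ^+ 2)) (dk (1 + t ^+ 2) * (2 * t)).
  by move=> hk; apply: (@is_derive_chain R R (fun t : R => 1 + t ^+ 2) k); auto.
have dm n (c : R) t : is_derive t (1 : R) (fun t : R => c * t ^+ n.+1)
    (c * (n.+1%:R * t ^+ n)).
  by apply: (is_derive_eq (is_derive_cmulf (is_derive_expf (is_derive_idR t) n) c));
    rewrite mulr1.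
have f1 t : 'D_1 f t = g (1 + t ^+ 2) + 2 * t ^+ 2 * g1 (1 + t ^+ 2).
  rewrite (_ : f = fun t => t * g (1 + t ^+ 2)); last exact/funext.
  apply: derive_val.
  apply: (is_derive_eq (is_derive_mulf (is_derive_idR t) (dc _ _ t dg))).
  ring.
have f2 t : 'D_1 (fun t => 'D_1 f t) t =
    6 * t ^+ 1 * g1 (1 + t ^+ 2) + 4 * t ^+ 3 * g2 (1 + t ^+ 2).
  rewrite (funext f1).
  apply: derive_val.
  apply: (is_derive_eq (is_derive_addf (dc _ _ t dg)
    (is_derive_mulf (dm 1%N 2 t) (dc _ _ t dg1)))).
  ring.
rewrite (funext f2).
apply: derive_val.
apply: (is_derive_eq (is_derive_addf
  (is_derive_mulf (dm 0%N 6 0) (dc _ _ 0 dg1))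
  (is_derive_mulf (dm 2%N 4 0) (dc _ _ 0 dg2)))).
have -> : 1 + (0 : R) ^+ 2 = 1 by rewrite expr0n addr0.
rewrite -[X in _ = 6 * X]/(g1 1); ring.
Qed.

(** Off the zeros of [f] the hypothesis says that [f t / t] has derivative 0,
    but [f] might still vanish on one part of the half-line only. The square
    of [f t / t] has derivative 0 everywhere on [D], which excludes this. *)
Lemma homogeneous_half_line (D : set R) (f f' : R -> R) :
  (forall x y z, D x -> D y -> x <= z -> z <= y -> D z) ->
  (forall t, D t -> t != 0) ->
  (forall t, D t -> is_derive t 1 f (f' t)) ->
  (forall t, D t -> f t * (f t - t * f' t) = 0) ->
  exists c, forall t, D t -> f t = c * t.
Proof.
move=> cD D0 df fE.
have [[a Da]|nD] := pselect (exists a, D a); last first.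
  by exists 0 => t Dt; case: nD; exists t.
have dq t : D t -> is_derive t 1 (fun t => f t / t) ((f' t * t - f t * 1) / t ^+ 2).
  by move=> Dt; exact: (is_derive_divf (df t Dt) (is_derive_idR t) (D0 t Dt)).
have sq t : D t -> (f t / t) ^+ 2 = (f a / a) ^+ 2.
  move=> Dt; apply: (@derive0_cst D (fun t => (f t / t) ^+ 2) cD _ t a Dt Da) => s Ds.
  apply: (is_derive_eq (is_derive_expf (dq s Ds) 1)).
  have s0 := D0 _ Ds.
  rewrite [LHS](_ : _ = - 2 * (f s * (f s - s * f' s)) / s ^+ 3); last by field.
  by rewrite fE// mulr0 mul0r.
have [fa0|fa0] := eqVneq (f a) 0.
  exists 0 => t Dt; rewrite mul0r; move: (sq t Dt).
  rewrite fa0 mul0r expr0n /= => /eqP; rewrite sqrf_eq0 mulf_eq0 invr_eq0.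
  by rewrite (negbTE (D0 t Dt)) orbF => /eqP.
exists (f a / a) => t Dt; rewrite -[LHS](divfK (D0 t Dt)); congr (_ * _).
apply: (@derive0_cst D (fun t => f t / t) cD _ t a Dt Da) => s Ds.
apply: (is_derive_eq (dq s Ds)).
have /eqP := fE s Ds; rewrite mulf_eq0 => /orP[|/eqP fs].
  move=> /eqP fs0; move: (sq s Ds); rewrite fs0 mul0r expr0n /= => /esym/eqP.
  by rewrite sqrf_eq0 mulf_eq0 invr_eq0 (negbTE fa0) (negbTE (D0 a Da)).
by rewrite [X in X / _](_ : _ = - (f s - s * f' s)); [rewrite fs oppr0 mul0r|ring].
Qed.

(** The slopes on the two half-lines agree because the derivative is continuous
    at 0. *)
Lemma homogeneous_line (f : R -> R) :
  Ck 1 setT f -> (forall t, f t * (f t - t * derive1 f t) = 0) ->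
  exists c, forall t, f t = c * t.
Proof.
move=> cf fE.
have df t : is_derive t (1 : R) f (derive1 f t) by rewrite derive1E; exact: Ck_is_derive cf _.
have [|||c hc] := @homogeneous_half_line [set t : R | 0 < t] f (derive1 f).
- by move=> x y z /= x0 _ xz _; exact: lt_le_trans xz.
- by move=> t /= /lt0r_neq0.
- by move=> t _; exact: fE.
have [|||d hd] := @homogeneous_half_line [set t : R | t < 0] f (derive1 f).
- by move=> x y z /= _ y0 _ zy; exact: le_lt_trans zy _.
- by move=> t /= /ltr0_neq0.
- by move=> t _; exact: fE.
have lin (k t : R) : is_derive t (1 : R) (fun t : R => k * t) k.
  by apply: (is_derive_eq (is_derive_cmulf (is_derive_idR t) k)); rewrite mulr1.
have opos : open [set t : R | 0 < t] by exact: open_gt.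
have oneg : open [set t : R | t < 0] by exact: open_lt.
have Dc t : 0 < t -> derive1 f t = c.
  move=> t0; rewrite derive1E; apply: derive_val.
  by apply: (is_derive_eq_open opos t0 _ (lin c t)) => s /hc.
have Dd t : t < 0 -> derive1 f t = d.
  move=> t0; rewrite derive1E; apply: derive_val.
  by apply: (is_derive_eq_open oneg t0 _ (lin d t)) => s /hd.
have cD : {for (0 : R), continuous (derive1 f)}.
  apply: (Ck_continuous (k := 0) (U := setT)) => //.
  apply: (eq_Ck openT _ (Ck_derive (1 : R) cf)) => z _.
  by rewrite derive1E.
have D0 k : (forall e : R, 0 < e -> exists2 t, `|t| < e & derive1 f t = k) -> derive1 f 0 = k.
  move=> hk; apply/eqP; rewrite -[_ == _]negbK; apply/negP => ne.
  have e0 : 0 < `|derive1 f 0 - k| by rewrite normr_gt0 subr_eq0.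
  have : nbhs (0 : R) [set t | `|derive1 f 0 - derive1 f t| < `|derive1 f 0 - k| ].
    exact: continuous_near.
  move=> /nbhs_ballP[e /= e1 eN]; have [t te tk] := hk e e1.
  have : ball (0 : R) e t by rewrite -ball_normE /= sub0r normrN.
  by move=> /eN /=; rewrite tk ltxx.
have cd : c = d.
  rewrite -(D0 c) ?(D0 d)// => e e0.
    exists (- (e / 2)); last by rewrite Dd// oppr_lt0 divr_gt0.
    by rewrite normrN gtr0_norm ?divr_gt0// gtr_pMr// invf_lt1// ltr1n.
  exists (e / 2); last by rewrite Dc// divr_gt0.
  by rewrite gtr0_norm ?divr_gt0// gtr_pMr// invf_lt1// ltr1n.
exists c => t; case: (ltgtP t 0) => [t0|t0|->].
- by rewrite cd; exact: hd.
- exact: hc.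
- by have := fE 0; rewrite mul0r subr0 mulr0 => /eqP; rewrite mulf_eq0 orbb => /eqP.
Qed.

Lemma derive1_quadratic (f : R -> R) (a c : R) :
  (forall z, f z = a + c * z ^+ 2) -> forall z, derive1 f z = 2 * c * z.
Proof.
move=> fE z; rewrite (funext fE) derive1E; apply: derive_val.
apply: (is_derive_eq (is_derive_addf (is_derive_cstf z (1 : R) a)
  (is_derive_cmulf (is_derive_expf (is_derive_idR z) 1) c))).
ring.
Qed.

Lemma open_between (a b : R) : open [set s : R | a < s < b].
Proof.
rewrite (_ : [set s : R | _] = [set s | a < s] `&` [set s | s < b]).
  by apply: openI; [exact: open_gt|exact: open_lt].
by apply/seteqP; split=> s /=; [move=> /andP[]|move=> [-> ->]].
Qed.

Lemma between_convex (a b x y z : R) : a < x < b -> a < y < b ->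
  x <= z -> z <= y -> a < z < b.
Proof.
move=> /andP[ax _] /andP[_ yb] xz zy.
by rewrite (lt_le_trans ax xz) (le_lt_trans zy yb).
Qed.

Lemma third_derivative_line (V : normedModType R) (f : V -> R) (y v : V) :
  'D_v (fun y => 'D_v (fun y => 'D_v f y) y) y =
  'D_1 (fun t : R => 'D_1 (fun t : R => 'D_1 (fun t : R => f (y + t *: v)) t) t) (0 : R).
Proof.
have line (g : V -> R) (t : R) : 'D_1 (fun t : R => g (y + t *: v)) t = 'D_v g (y + t *: v).
  apply: (@derive_affine R V R (fun t : R => y + t *: v) g t 1 v) => h.
  by rewrite [h%:A]mulr1 scalerDl addrCA.
rewrite (funext (line f)) (funext (line (fun y => 'D_v f y))).
by rewrite (line (fun y => 'D_v (fun y => 'D_v f y) y)) scale0r addr0.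
Qed.

Lemma Ck_sqrt k : Ck k [set s : R | 0 < s] (@Num.sqrt R).
Proof.
have opos : open [set s : R | 0 < s] by exact: open_gt.
elim: k => [|k IH]; split=> //; try by move=> s s0;
  apply/derivable1_diffP; have [] := is_derive1_sqrt s0.
move=> v; apply: (eq_Ck opos (f := fun s => v * (2 * Num.sqrt s)^-1)).
  move=> s s0; have ds : differentiable (@Num.sqrt R) s.
    by apply/derivable1_diffP; have [] := is_derive1_sqrt s0.
  rewrite -[v in RHS]mulr1 -[v * 1]/(v *: (1 : R)) derive_scale//; congr (_ * _).
  by apply/esym/derive_val; exact: is_derive1_sqrt.
apply: CkM => //; first exact: Ck_cst.
apply: CkV => //; last by apply: CkM => //; exact: Ck_cst.
by move=> s s0; rewrite mulf_neq0 ?pnatr_eq0// gt_eqF// sqrtr_gt0.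
Qed.

(** As [s] runs through the squared norms of the spatial part along a line,
    [z / Num.sqrt s] runs through the slopes. *)
Lemma Ck_slope_of_square k (u : R -> R) (z : R) :
  Ck k setT u -> Ck k [set s : R | 0 < s] (fun s => u (z / Num.sqrt s)).
Proof.
move=> cu; have opos : open [set s : R | 0 < s] by exact: open_gt.
apply: (@Ck_comp R R k [set s : R | 0 < s] setT (fun s => z / Num.sqrt s) u) => //.
  exact: openT.
apply: CkM => //; first exact: Ck_cst.
by apply: CkV => //; [move=> s s0; rewrite gt_eqF// sqrtr_gt0|exact: Ck_sqrt].
Qed.

Lemma is_derive_slope_of_square (u : R -> R) (z : R) :
  is_derive z (1 : R) u (derive1 u z) ->
  is_derive (1 : R) (1 : R) (fun s => u (z / Num.sqrt s)) (- (z * derive1 u z / 2)).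
Proof.
move=> du.
have ds : is_derive (1 : R) (1 : R) (@Num.sqrt R) (2 * Num.sqrt 1)^-1 := is_derive1_sqrt ltr01.
have dz : is_derive (1 : R) (1 : R) (fun s : R => z / Num.sqrt s) (- (z / 2)).
  have s0 : Num.sqrt 1 != 0 :> R by rewrite sqrtr1 oner_neq0.
  apply: (is_derive_eq (is_derive_cmulf (is_derive_invf ds s0) z)).
  by rewrite sqrtr1; field.
have du1 : is_derive (z / Num.sqrt 1) (1 : R) u (derive1 u z) by rewrite sqrtr1 divr1.
by apply: (is_derive_eq (is_derive_chain dz du1)); field.
Qed.

End MeanValue.

(** * The spatial inner product *)

Section Spatial.
Variables (R : realType) (n : nat).
Local Notation E := 'rV[R]_n.+1.
Implicit Types (u v w x y : E).

(** Together with [sradius] and [time_part] this replaces the coordinates of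
    the space part, so that derivatives can be taken in any direction. *)
Definition sdot u v : R := \sum_(i < n) u 0 (lift ord0 i) * v 0 (lift ord0 i).

Definition sradius u : R := enorm (space_part u).

Lemma sdotC u v : sdot u v = sdot v u.
Proof. by apply: eq_bigr => i _; rewrite mulrC. Qed.

Lemma sdotDl u v w : sdot (u + v) w = sdot u w + sdot v w.
Proof. by rewrite /sdot -big_split; apply: eq_bigr => i _; rewrite mxE mulrDl. Qed.

Lemma sdotZl (c : R) u w : sdot (c *: u) w = c * sdot u w.
Proof. by rewrite /sdot mulr_sumr; apply: eq_bigr => i _; rewrite mxE mulrA. Qed.

Lemma sdotDr u v w : sdot u (v + w) = sdot u v + sdot u w.
Proof. by rewrite sdotC sdotDl !(sdotC u). Qed.

Lemma sdotZr (c : R) u w : sdot u (c *: w) = c * sdot u w.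
Proof. by rewrite sdotC sdotZl (sdotC u). Qed.

Lemma sdot_ge0 u : 0 <= sdot u u.
Proof. by apply: sumr_ge0 => i _; rewrite -expr2 sqr_ge0. Qed.

Lemma sradiusE u : sradius u = Num.sqrt (sdot u u).
Proof. by congr Num.sqrt; apply: eq_bigr => i _; rewrite mxE expr2. Qed.

Lemma sradius_sq u : sradius u ^+ 2 = sdot u u.
Proof. by rewrite sradiusE sqr_sqrtr// sdot_ge0. Qed.

Lemma sradius_ge0 u : 0 <= sradius u.
Proof. by rewrite sradiusE sqrtr_ge0. Qed.

Lemma space_part_eq0 u : (space_part u == 0) = (sdot u u == 0).
Proof.
apply/eqP/eqP => [/rowP u0|u0].
  by rewrite /sdot big1// => i _; have := u0 i; rewrite !mxE => ->; rewrite mul0r.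
apply/rowP => i; rewrite !mxE; apply/eqP.
have /eqP := u0; rewrite psumr_eq0; last by move=> j _; rewrite -expr2 sqr_ge0.
by move=> /allP/(_ i (mem_index_enum _)); rewrite /= mulf_eq0 orbb.
Qed.

Lemma sradius_gt0 u : (0 < sradius u) = (space_part u != 0).
Proof. by rewrite sradiusE sqrtr_gt0 space_part_eq0 lt_def sdot_ge0 andbT. Qed.

Lemma space_neq0 (u : E) : space_part u != 0 -> u != 0.
Proof.
apply: contraNneq => ->; rewrite space_part_eq0 -[X in sdot X _](scale0r (0 : E)).
by rewrite sdotZl mul0r.
Qed.

Lemma sdot_unit0 u : sdot u (unit_vec R ord0) = 0.
Proof. by rewrite /sdot big1// => i _; rewrite mxE /= mulr0. Qed.

Lemma sdot_unitS u i : sdot u (unit_vec R (lift ord0 i)) = u 0 (lift ord0 i).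
Proof.
rewrite /sdot (bigD1 i)//= big1 ?addr0 => [|j ji].
  by rewrite mxE !eqxx mulr1.
by rewrite mxE (inj_eq lift_inj) (negbTE ji) mulr0.
Qed.

Lemma time_partD (u v : E) : time_part (u + v) = time_part u + time_part v.
Proof. by rewrite /time_part mxE. Qed.

Lemma time_partZ (c : R) (u : E) : time_part (c *: u) = c * time_part u.
Proof. by rewrite /time_part mxE. Qed.

Lemma time_unit0 : time_part (unit_vec R (@ord0 n)) = 1.
Proof. by rewrite /time_part mxE !eqxx. Qed.

Lemma time_unitS (i : 'I_n) : time_part (unit_vec R (lift ord0 i)) = 0.
Proof. by rewrite /time_part mxE. Qed.

Lemma time_sum u : \sum_A u 0 A * time_part (unit_vec R A) = time_part u.
Proof.
rewrite big_ord_recl time_unit0 mulr1 big1 ?addr0// => i _.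
by rewrite time_unitS mulr0.
Qed.

Lemma sdot_sum u w : \sum_A w 0 A * sdot u (unit_vec R A) = sdot u w.
Proof.
rewrite big_ord_recl sdot_unit0 mulr0 add0r.
by apply: eq_bigr => i _; rewrite sdot_unitS mulrC.
Qed.

Lemma is_derive_coord x v B : is_derive x v (fun y : E => y 0 B) (v 0 B).
Proof.
apply: (@is_derive_affine R R E (fun y : E => y 0 B) id x v (v 0 B)).
by move=> h; rewrite !mxE.
Qed.

Lemma is_derive_sdot_self x v : is_derive x v (fun y => sdot y y) (2 * sdot x v).
Proof.
have h i := is_derive_mulf (is_derive_coord x v (lift ord0 i))
  (is_derive_coord x v (lift ord0 i)).
apply: (is_derive_eq (is_derive_sumf h)).
by rewrite /sdot mulr_sumr; apply: eq_bigr => i _; ring.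
Qed.

Lemma is_derive_sdot x v w : is_derive x v (fun y => sdot y w) (sdot v w).
Proof.
apply: (@is_derive_affine R R E (fun y : E => sdot y w) id x v (sdot v w)).
by move=> h; rewrite sdotDl sdotZl.
Qed.

Lemma is_derive_time x v : is_derive x v (@time_part R n) (time_part v).
Proof. exact: is_derive_coord. Qed.

Lemma is_derive_radius x v : space_part x != 0 ->
  is_derive x v sradius (sdot x v / sradius x).
Proof.
move=> x0; rewrite (_ : sradius = fun y => Num.sqrt (sdot y y)); last first.
  by apply/funext => y; rewrite sradiusE.
have s0 : 0 < sdot x x by rewrite lt_def sdot_ge0 -space_part_eq0 x0.
apply: (is_derive_eq (is_derive_chain (is_derive_sdot_self x v) (is_derive1_sqrt s0))).
have r0 : Num.sqrt (sdot x x) != 0 by rewrite gt_eqF// sqrtr_gt0.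
by field.
Qed.

(** * The slit tangent bundle *)

Lemma Ck_coord k (B : 'I_n.+1) : Ck k setT (fun y : E => y 0 B).
Proof.
case: k => [|k]; split=> //; try by move=> x _; exact: differentiable_coord.
move=> v; apply: (eq_Ck openT _ (Ck_cst openT k (v 0 B))) => x _.
by apply/esym/derive_val; exact: is_derive_coord.
Qed.

Lemma continuous_radius : continuous sradius.
Proof.
rewrite (_ : sradius = fun y => Num.sqrt (sdot y y)); last first.
  by apply/funext => y; rewrite sradiusE.
move=> y; apply: continuous_comp; last exact: sqrt_continuous.
apply: (Ck_continuous (k := 0) (U := setT)) => //.
by apply: Ck_sum => [|i _]; [exact: openT|apply: CkM; [exact: openT|exact: Ck_coord..]].
Qed.

Lemma open_cylinder (rho : R) : open (cylinder rho : set E).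
Proof.
by apply: (@open_comp _ _ sradius [set r | r < rho]);
  [move=> x _; exact: continuous_radius|exact: open_lt].
Qed.

Lemma open_space : open [set x : E | space_part x != 0].
Proof.
rewrite (_ : [set x | _] = sradius @^-1` [set r | 0 < r]).
  by apply: open_comp; [move=> x _; exact: continuous_radius|exact: open_gt].
by apply/seteqP; split=> x /=; rewrite sradius_gt0.
Qed.

Lemma open_neq0 : open [set y : E | y != 0].
Proof.
rewrite (_ : [set y : E | y != 0] = (fun y : E => `|y|) @^-1` [set r : R | 0 < r]).
  by apply: open_comp; [move=> x _; exact: norm_continuous|exact: open_gt].
by apply/seteqP; split=> x /=; rewrite normr_gt0.
Qed.

Lemma open_slit (rho : R) : open (slit_tangent rho : set (E * E)).
Proof.
rewrite (_ : slit_tangent rho = (fst @^-1` (cylinder rho : set E)) `&`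
    (snd @^-1` [set y : E | y != 0])).
  by apply: openI; apply: open_comp;
    [move=> p _; exact: cvg_fst|exact: open_cylinder
    |move=> p _; exact: cvg_snd|exact: open_neq0].
by apply/seteqP; split=> -[x y].
Qed.

End Spatial.

(** * Smoothness of the spray *)

Section Uncurried.
Variables (R : realType) (n : nat).
Local Notation E := 'rV[R]_n.+1.
Implicit Types (f : E -> E -> R) (F : E -> E -> R) (S : set (E * E)).

Definition on_pairs f : E * E -> R := fun p => f p.1 p.2.

Lemma d_y_pairs f A x y :
  d_y A f x y = 'D_((0 : E, unit_vec R A)) (on_pairs f) (x, y).
Proof.
rewrite /d_y (_ : f x = fun y => on_pairs f (x, y))//.
apply: (@derive_affine _ _ _ (fun y : E => (x, y)) (on_pairs f)) => h.
by congr pair; rewrite /= ?scaler0 ?add0r.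
Qed.

Lemma d_x_pairs f A x y :
  d_x A f x y = 'D_((unit_vec R A, 0 : E)) (on_pairs f) (x, y).
Proof.
rewrite /d_x (_ : (fun x => f x y) = fun x => on_pairs f (x, y))//.
apply: (@derive_affine _ _ _ (fun x : E => (x, y)) (on_pairs f)) => h.
by congr pair; rewrite /= ?scaler0 ?add0r.
Qed.

Lemma Ck_d_y k S f A : open S -> Ck k.+1 S (on_pairs f) -> Ck k S (on_pairs (d_y A f)).
Proof.
move=> oS cf; apply: (eq_Ck oS _ (Ck_derive (0 : E, unit_vec R A) cf)) => -[x y] _.
by rewrite /on_pairs /= d_y_pairs.
Qed.

Lemma Ck_d_x k S f A : open S -> Ck k.+1 S (on_pairs f) -> Ck k S (on_pairs (d_x A f)).
Proof.
move=> oS cf; apply: (eq_Ck oS _ (Ck_derive (unit_vec R A, 0 : E) cf)) => -[x y] _.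
by rewrite /on_pairs /= d_x_pairs.
Qed.

Lemma Ck_y_coord k S (B : 'I_n.+1) : open S -> Ck k S (fun p : E * E => p.2 0 B).
Proof.
move=> oS; apply: (@Ck_affine R E (E * E)%type k setT S snd snd (fun y : E => y 0 B)) => //.
- exact: openT.
- by move=> p; apply: linear_differentiable => q; exact: cvg_snd.
- exact: Ck_coord.
Qed.

Lemma pos_def_unitmx (a : 'M[R]_n.+1) : pos_def a -> a \in unitmx.
Proof.
move=> pa; rewrite unitmxE unitfE; apply/negP => /det0P[v v0 va].
have := pa v v0; suff -> : quad_form a v = 0 by rewrite ltxx.
rewrite /quad_form exchange_big big1// => B _.
have := congr1 (fun w : 'rV_n.+1 => w 0 B) va; rewrite !mxE => vaB.
rewrite -mulr_suml [X in X * _](_ : _ = 0) ?mul0r// -[RHS]vaB.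
by apply: eq_bigr => A _; rewrite mulrC.
Qed.

Lemma fundamental_tensorE F x y A B :
  fundamental_tensor (F x) y A B = 2^-1 * d_y B (d_y A (energy F)) x y.
Proof. by rewrite mxE. Qed.

Section Finsler.
Variables (rho : R) (F : E -> E -> R).
Hypothesis hF : finsler_metric rho F.
Let S : set (E * E) := slit_tangent rho.
Let oS : open S := @open_slit R n rho.

Lemma Ck_metric k : Ck k S (on_pairs F).
Proof. by have [sF _] := hF; exact: (proj1 (smooth_onP S (on_pairs F)) sF k). Qed.

Lemma Ck_energy k : Ck k S (on_pairs (energy F)).
Proof. exact: (CkX oS 2 (Ck_metric k)). Qed.

Lemma Ck_fundamental_tensor k A B :
  Ck k S (fun p => fundamental_tensor (F p.1) p.2 A B).
Proof.
apply: (eq_Ck oS _ (CkM oS (Ck_cst oS k 2^-1)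
  (Ck_d_y B oS (Ck_d_y A oS (Ck_energy k.+2))))) => p _.
by rewrite fundamental_tensorE.
Qed.

Lemma fundamental_tensor_unit x y : S (x, y) -> fundamental_tensor (F x) y \in unitmx.
Proof.
move=> [cx y0]; apply: pos_def_unitmx.
by case: hF => _ /(_ x cx)[_ _ _]; exact.
Qed.

Lemma fundamental_tensor_sym x y A B : S (x, y) ->
  fundamental_tensor (F x) y A B = fundamental_tensor (F x) y B A.
Proof.
move=> Sxy; rewrite (fundamental_tensorE F x y A B) (fundamental_tensorE F x y B A).
have pairs C : on_pairs (d_y C (energy F)) =
    fun p => 'D_((0 : E, unit_vec R C)) (on_pairs (energy F)) p.
  by apply/funext => -[u w]; rewrite /on_pairs d_y_pairs.
have e C D : d_y D (d_y C (energy F)) x y = 'D_((0 : E, unit_vec R D))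
    (fun p => 'D_((0 : E, unit_vec R C)) (on_pairs (energy F)) p) (x, y).
  by rewrite d_y_pairs (pairs C).
have sw := derive_swap (0 : E, unit_vec R A) (0 : E, unit_vec R B) oS Sxy (Ck_energy 2).
have AB : d_y B (d_y A (energy F)) x y = d_y A (d_y B (energy F)) x y.
  exact: (etrans (e A B) (etrans sw (esym (e B A)))).
exact: (congr1 (fun t => 2^-1 * t) AB).
Qed.

Lemma Ck_spray k C : Ck k S (on_pairs (spray F C)).
Proof.
have mxE' p : \matrix_(i, j) fundamental_tensor (F p.1) p.2 i j =
    fundamental_tensor (F p.1) p.2.
  by apply/matrixP => i j; rewrite mxE.
apply: (CkM oS (Ck_cst oS k 4^-1)); apply: Ck_sum => // A _; apply: CkM => //.
  apply: (eq_Ck oS _ (Ck_invmx oS _ (fun i j => Ck_fundamental_tensor k i j) C A)).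
    by move=> p _; rewrite mxE'.
  by move=> [x y] Sp; rewrite mxE'; exact: fundamental_tensor_unit.
apply: CkB => //; last exact: (Ck_d_x A oS (Ck_energy k.+1)).
apply: Ck_sum => // B _; apply: CkM => //; last exact: Ck_y_coord.
exact: (Ck_d_x B oS (Ck_d_y A oS (Ck_energy k.+2))).
Qed.

Lemma Ck_berwald k A B C D : Ck k S (on_pairs (berwald_tensor F A B C D)).
Proof.
exact: (Ck_d_y D oS (Ck_d_y C oS (Ck_d_y B oS (Ck_spray k.+3 A)))).
Qed.

(** The fundamental tensor being invertible, the spray is the only solution of
    the geodesic equations, which saves computing the inverse matrix. *)
Lemma spray_unique x y (H : E) : S (x, y) ->
  (forall A, \sum_B 2 * d_y B (d_y A (energy F)) x y * H 0 B =
     \sum_B d_x B (d_y A (energy F)) x y * y 0 B - d_x A (energy F) x y) ->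
  forall C, spray F C x y = H 0 C.
Proof.
move=> Sxy eqH C; set g := fundamental_tensor (F x) y.
have gu : g \in unitmx by exact: fundamental_tensor_unit.
have -> : H 0 C = (invmx g *m (g *m H^T)) C 0 by rewrite mulKmx// mxE.
rewrite mxE /spray mulr_sumr; apply: eq_bigr => A _; rewrite mulrCA; congr (_ * _).
rewrite -eqH mxE mulr_sumr; apply: eq_bigr => B _.
by rewrite fundamental_tensorE mxE; field.
Qed.

(** The Landsberg tensor contracts the Berwald tensor with [y_D]. *)
Lemma berwald_landsberg : is_berwald rho F -> is_landsberg rho F.
Proof.
move=> bF x y Sxy A B C; rewrite /landsberg_tensor big1 ?mulr0// => D _.
by have := bF x y Sxy D A B C; rewrite /berwald_tensor => ->; rewrite mulr0.
Qed.

End Finsler.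
End Uncurried.

(** * The profile of the energy at a fixed radius *)

Section Profile.
Variable R : realType.
Implicit Types (p q : R -> R).

(** For an energy [b ^+ 2 * p (a / b)] on the plane of [a = y^0] and
    [b = |y'|], with [y'] the spatial part of [y], and with [z = a / b],
    [transverse] is the coefficient [E_b / b] of the Hessian in the spatial
    directions orthogonal to [y'], [mixed] its entry [E_ab], and [planar_det]
    its determinant on this plane. In the comments [M] and [D] stand for
    [transverse p] and [planar_det p]. *)
Definition transverse p (z : R) : R := 2 * p z - z * derive1 p z.

Definition mixed p (z : R) : R := derive1 p z - z * derive1 (derive1 p) z.

Definition planar_det p (z : R) : R :=
  2 * p z * derive1 (derive1 p) z - derive1 p z ^+ 2.

(** With [q] the derivative of the profile in the radius, these are the functions
    [u] and [v] of the slope for which moving [(a, b)] with velocity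
    [(b * u, b * v)] reproduces the change of the energy (lemma [rates]). Among
    all such pairs they are the one that solves the geodesic equations. *)
Definition time_rate p q (z : R) : R :=
  (derive1 q z * transverse p z - q z * mixed p z) / (2 * planar_det p z).

Definition space_rate p q (z : R) : R :=
  q z / transverse p z - derive1 p z / transverse p z * time_rate p q z.

Section Regular.
Variables (p q : R -> R).
Hypotheses (cp : forall k, Ck k setT p) (cq : forall k, Ck k setT q).

Local Notation p1 := (derive1 p).
Local Notation p2 := (derive1 (derive1 p)).

Lemma smooth_derive1 (f : R -> R) : (forall k, Ck k setT f) ->
  forall k, Ck k setT (derive1 f).
Proof.
move=> cf k; apply: (eq_Ck openT _ (Ck_derive (1 : R) (cf k.+1))) => z _.
by rewrite derive1E.
Qed.

Lemma smooth_is_derive1 (f : R -> R) (z : R) : (forall k, Ck k setT f) ->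
  is_derive z (1 : R) f (derive1 f z).
Proof. by move=> cf; rewrite derive1E; exact: (Ck_is_derive (1 : R) (cf 0%N) I). Qed.

Lemma Ck_idR k (D : set R) : open D -> Ck k D (fun z : R => z).
Proof.
move=> oD; case: k => [|k]; split=> //.
move=> v; apply: (eq_Ck oD _ (Ck_cst oD k v)) => z _.
by rewrite derive_id.
Qed.

Let oT : open [set: R] := openT.
Let dp z : is_derive z (1 : R) p (p1 z) := smooth_is_derive1 z cp.
Let dp1 z : is_derive z (1 : R) p1 (p2 z) := smooth_is_derive1 z (smooth_derive1 cp).
Let dq z : is_derive z (1 : R) q (derive1 q z) := smooth_is_derive1 z cq.

Lemma Ck_transverse k : Ck k setT (transverse p).
Proof.
apply: CkB => //; first by apply: CkM => //; exact: Ck_cst.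
by apply: CkM => //; [exact: Ck_idR|exact: smooth_derive1].
Qed.

Lemma Ck_mixed k : Ck k setT (mixed p).
Proof.
apply: CkB => //; first exact: smooth_derive1.
by apply: CkM => //; [exact: Ck_idR|do 2!apply: smooth_derive1].
Qed.

Lemma Ck_planar_det k : Ck k setT (planar_det p).
Proof.
apply: CkB => //; last by apply: CkX => //; exact: smooth_derive1.
apply: CkM => //; last by do 2!apply: smooth_derive1.
by apply: CkM => //; exact: Ck_cst.
Qed.

Lemma is_derive_transverse z : is_derive z (1 : R) (transverse p) (mixed p z).
Proof.
apply: (is_derive_eq (is_derive_subf (is_derive_cmulf (dp z) 2)
  (is_derive_mulf (is_derive_idR z) (dp1 z)))).
rewrite /mixed; ring.
Qed.

Hypothesis M0 : forall z, 0 < transverse p z.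
Hypothesis P0 : forall z, 0 < derive1 p1 z.
Hypothesis D0 : forall z, 0 < planar_det p z.

Let Mn0 z : transverse p z != 0 := lt0r_neq0 (M0 z).
Let Dn0 z : planar_det p z != 0 := lt0r_neq0 (D0 z).

Lemma profile_gt0 z : 0 < p z.
Proof.
have : 0 < 2 * p z * p2 z.
  by rewrite (lt_le_trans (D0 z))// /planar_det lerBlDr lerDl sqr_ge0.
by rewrite pmulr_lgt0// pmulr_rgt0.
Qed.

Lemma Ck_time_rate k : Ck k setT (time_rate p q).
Proof.
apply: CkM => //; last first.
  apply: CkV => //; last by apply: CkM => //; [exact: Ck_cst|exact: Ck_planar_det].
  by move=> z _; rewrite mulf_neq0 ?pnatr_eq0.
apply: CkB => //; apply: CkM => //.
- exact: smooth_derive1.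
- exact: Ck_transverse.
- exact: Ck_mixed.
Qed.

Lemma Ck_space_rate k : Ck k setT (space_rate p q).
Proof.
have cV : Ck k setT (fun z => (transverse p z)^-1).
  by apply: CkV => //; exact: Ck_transverse.
apply: CkB => //; first exact: CkM.
apply: CkM => //; last exact: Ck_time_rate.
by apply: CkM => //; exact: smooth_derive1.
Qed.

Let du z : is_derive z (1 : R) (time_rate p q) (derive1 (time_rate p q) z) :=
  smooth_is_derive1 z Ck_time_rate.

Lemma rates z : q z = transverse p z * space_rate p q z + derive1 p z * time_rate p q z.
Proof. by rewrite /space_rate; field. Qed.

(** With [T = p' / M] one has [T' = D / M ^+ 2]; the definition of the time rate
    [u] says that [(q / M)' = 2 * T' * u], and [v] is [q / M - T * u]. *)
Lemma derive_space_rate z : derive1 (space_rate p q) z =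
  planar_det p z / transverse p z ^+ 2 * time_rate p q z -
  derive1 p z / transverse p z * derive1 (time_rate p q) z.
Proof.
rewrite derive1E; apply: derive_val.
have dM := is_derive_transverse.
apply: (is_derive_eq (is_derive_subf (is_derive_divf (dq z) (dM z) (Mn0 z))
  (is_derive_mulf (is_derive_divf (dp1 z) (dM z) (Mn0 z)) (du z)))).
have eq1 : derive1 q z * transverse p z - q z * mixed p z =
    2 * planar_det p z * time_rate p q z.
  by rewrite /time_rate; field.
have eq2 : p2 z * transverse p z - p1 z * mixed p z = planar_det p z.
  by rewrite /transverse /mixed /planar_det; ring.
by rewrite eq1 eq2; field.
Qed.

(** The hypothesis is the vanishing of the Landsberg tensor on the thrice
    repeated direction of [x], at a [y] orthogonal to [x]. Inserting
    [v' = T' * u - T * u'] cancels [u'] and leaves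
    [(p' * M - z * D) * u = 0], whose first factor is [2 * p] times [mixed]. *)
Lemma landsberg_profile z :
  derive1 p z * (time_rate p q z - z * derive1 (time_rate p q) z) =
    transverse p z * (z * derive1 (space_rate p q) z) ->
  time_rate p q z * mixed p z = 0.
Proof.
rewrite derive_space_rate; set u := time_rate p q z; set u' := derive1 (time_rate p q) z => h.
have : 2 * p z * (u * mixed p z) = 0.
  have -> : 2 * p z * (u * mixed p z) =
      transverse p z * (p1 z * (u - z * u')) - transverse p z *
      (transverse p z * (z * (planar_det p z / transverse p z ^+ 2 * u -
         p1 z / transverse p z * u'))).
    have -> : transverse p z * (transverse p z * (z *
        (planar_det p z / transverse p z ^+ 2 * u - p1 z / transverse p z * u'))) =
        z * (planar_det p z * u - transverse p z * p1 z * u').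
      by field.
    by rewrite /transverse /mixed /planar_det; ring.
  by rewrite h subrr.
move/eqP; rewrite mulf_eq0 mulf_eq0 pnatr_eq0 /= gt_eqF ?profile_gt0//=.
by move/eqP.
Qed.

(** Once [u = l * z], the derivative of [v] is a multiple of [l * mixed], and so
    [v] is constant. *)
Lemma linear_rates :
  (forall z, time_rate p q z * mixed p z = 0) ->
  (forall z, time_rate p q z != 0 ->
     time_rate p q z = z * derive1 (time_rate p q) z) ->
  exists l v, [/\ forall z, time_rate p q z = l * z,
    forall z, space_rate p q z = v & forall z, l * mixed p z = 0].
Proof.
move=> uchi uz.
have [l ul] : exists l, forall z, time_rate p q z = l * z.
  apply: homogeneous_line => [|z]; first exact: Ck_time_rate.
  by have [->|/uz <-] := eqVneq (time_rate p q z) 0; rewrite ?mul0r// subrr mulr0.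
have lchi z : l * mixed p z = 0.
  have lchi s : s != 0 -> l * mixed p s = 0.
    by move=> s0; have := uchi s; rewrite ul mulrAC => /eqP;
      rewrite mulf_eq0 (negbTE s0) orbF => /eqP.
  have [->|/lchi//] := eqVneq z 0.
  apply: (@continuous_eq_nearby R R (fun s => l * mixed p s) (fun=> 0)).
  - apply: (Ck_continuous (k := 0) (U := setT)) => //.
    exact: (CkM oT (Ck_cst oT 0 l) (Ck_mixed 0)).
  - exact: cst_continuous.
  move=> d d0; have d2 : 0 < d / 2 by rewrite divr_gt0.
  have bd : ball (0 : R) d (d / 2).
    rewrite -ball_normE /= sub0r normrN gtr0_norm//.
    by rewrite gtr_pMr// invf_lt1// ltr1n.
  by exists (d / 2), (d / 2); split=> //; rewrite lchi// gt_eqF.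
exists l, (space_rate p q 0); split=> // z.
apply: (@derive0_cst R setT) => // s _.
have dv : is_derive s (1 : R) (space_rate p q) (derive1 (space_rate p q) s).
  exact: (smooth_is_derive1 s Ck_space_rate).
apply: (is_derive_eq dv).
have u's : derive1 (time_rate p q) s = l.
  rewrite (_ : time_rate p q = fun z => l * z); last exact/funext.
  rewrite derive1E; apply: derive_val.
  by apply: (is_derive_eq (is_derive_cmulf (is_derive_idR s) l)); rewrite mulr1.
rewrite derive_space_rate u's ul.
have -> : planar_det p s / transverse p s ^+ 2 * (l * s) -
    derive1 p s / transverse p s * l =
    - (2 * p s * (l * mixed p s)) / transverse p s ^+ 2.
  have -> : 2 * p s * (l * mixed p s) =
      derive1 p s * transverse p s * l - s * planar_det p s * l.
    by rewrite /transverse /mixed /planar_det; ring.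
  by field.
by rewrite lchi mulr0 oppr0 mul0r.
Qed.

Lemma is_derive_mixed z :
  is_derive z (1 : R) (mixed p) (- (z * derive1 (derive1 (derive1 p)) z)).
Proof.
have dp2 := smooth_is_derive1 z (smooth_derive1 (smooth_derive1 cp)).
apply: (is_derive_eq (is_derive_subf (dp1 z) (is_derive_mulf (is_derive_idR z) dp2))).
have alg (a b : R) : a - (b + a * 1) = - b by ring.
exact: alg.
Qed.

Lemma is_derive_planar_det z :
  is_derive z (1 : R) (planar_det p) (2 * p z * derive1 (derive1 (derive1 p)) z).
Proof.
have dp2 := smooth_is_derive1 z (smooth_derive1 (smooth_derive1 cp)).
apply: (is_derive_eq (is_derive_subf
  (is_derive_mulf (is_derive_cmulf (dp z) 2) dp2) (is_derive_expf (dp1 z) 1))).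
by rewrite expr1 [X in _ + X - _]mulrC addrK.
Qed.

(** The hypotheses are [p' = z * p''] with its derivatives in the slope and in
    the radius. By the first, [u = q' * M / (2 * D)]. By the last,
    [z * q'' = q'], and by the other one [z * p''' = 0], so that [z] times the
    derivative of every other term vanishes. *)
Lemma time_rate_homogeneous z : mixed p z = 0 -> derive1 (mixed p) z = 0 ->
  derive1 q z = z * derive1 (derive1 q) z ->
  time_rate p q z = z * derive1 (time_rate p q) z.
Proof.
move=> chi0 dchi0 hq.
have dm := is_derive_mixed z; have dD := is_derive_planar_det z.
have zp3 : z * derive1 (derive1 (derive1 p)) z = 0.
  by apply/eqP; rewrite -oppr_eq0 -(@derive_val _ _ _ _ _ _ _ dm) -derive1E dchi0.
have dq1 := smooth_is_derive1 z (smooth_derive1 cq).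
have D2 : 2 * planar_det p z != 0 by rewrite mulf_neq0 ?pnatr_eq0.
have du' := is_derive_divf (is_derive_subf
  (is_derive_mulf dq1 (is_derive_transverse z)) (is_derive_mulf (dq z) dm))
  (is_derive_cmulf dD 2) D2.
rewrite [derive1 (time_rate p q) z]derive1E (@derive_val _ _ _ _ _ _ _ du').
rewrite /time_rate chi0.
move: (Dn0 z) zp3 hq; move: (transverse p z) (planar_det p z) => M D Dz.
move: (derive1 (derive1 (derive1 p)) z) (derive1 (derive1 q) z) (derive1 q z).
move=> p3 q2 q1 zp3 hq.
rewrite [RHS](_ : _ = (M * (z * q2) * (2 * D) + q z * (z * p3) * z * (2 * D)
  - q1 * M * (2 * (2 * p z * (z * p3)))) / (2 * D) ^+ 2); last by field.
by rewrite zp3 -hq; field.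
Qed.

(** A profile with [p' = z * p''] is that of a Euclidean norm. *)
Lemma mixed0_quadratic : (forall z, mixed p z = 0) ->
  exists a c, forall z, p z = a + c * z ^+ 2.
Proof.
move=> chi0.
have [c hc] : exists c, forall z, p1 z = c * z.
  apply: homogeneous_line => [|z]; first exact: smooth_derive1.
  by have := chi0 z; rewrite /mixed => ->; rewrite mulr0.
exists (p 0), (c / 2) => z.
have d s : is_derive s (1 : R) (fun s => p s - c / 2 * s ^+ 2) 0.
  apply: (is_derive_eq (is_derive_subf (dp s)
    (is_derive_cmulf (is_derive_expf (is_derive_idR s) 1) (c / 2)))).
  by rewrite hc; field.
have := @derive0_cst R setT _ (fun _ _ _ _ _ _ _ => I) (fun s _ => d s) z 0 I I.
rewrite expr0n mulr0 subr0 => <-; ring.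
Qed.

End Regular.
End Profile.

(** * The energy in terms of its profile *)

Section RadialEnergy.
Variables (R : realType) (n : nat) (rho : R).
Local Notation E := 'rV[R]_n.+1.
Variables (F : E -> E -> R) (i1 i2 : 'I_n).
Hypothesis i12 : i1 != i2.
Hypothesis hF : finsler_metric rho F.

Local Notation e0 := (unit_vec R (@ord0 n)).
Local Notation e1 := (unit_vec R (lift ord0 i1)).
Local Notation e2 := (unit_vec R (lift ord0 i2)).
Local Notation S := (slit_tangent rho : set (E * E)).
Local Notation Eg := (on_pairs (energy F)).
Local Notation DZ f := (fun p : E * E => 'D_((0 : E, e0)) f p).
Local Notation DX f := (fun p : E * E => 'D_((e1, 0 : E)) f p).

(** By the symmetry and homogeneity of [F] these points represent all tangent
    vectors with non-zero spatial parts. Taking [e2] orthogonal to [e1] places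
    them where the radius is stationary along [y]. *)
Definition profile_point (r z : R) : E * E := (r *: e1, z *: e0 + e2).

Definition profile (r z : R) : R := Eg (profile_point r z).

Definition dprofile (r z : R) : R := 'D_((e1, 0 : E)) Eg (profile_point r z).

Let oS : open S := @open_slit R n rho.

Lemma e1_e2 : sdot e1 e2 = 0.
Proof. by rewrite sdot_unitS mxE (inj_eq lift_inj) eq_sym (negbTE i12). Qed.

Lemma e1_e1 : sdot e1 e1 = 1.
Proof. by rewrite sdot_unitS mxE !eqxx. Qed.

Lemma e2_e2 : sdot e2 e2 = 1.
Proof. by rewrite sdot_unitS mxE !eqxx. Qed.

Lemma sdot_e0 (u : E) : sdot e0 u = 0.
Proof. by rewrite sdotC sdot_unit0. Qed.

Definition sdot_units := (sdotDl, sdotZl, sdotDr, sdotZr, sdot_e0, sdot_unit0,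
  e1_e1, e2_e2, e1_e2, etrans (sdotC e2 e1) e1_e2).

Definition time_units := (time_partD, time_partZ, @time_unit0 R n, @time_unitS R n).

Lemma sradius_e1 r : 0 < r -> sradius (r *: e1) = r.
Proof.
move=> r0; rewrite sradiusE !sdot_units mulr1 -expr2 sqrtr_sqr.
by rewrite gtr0_norm.
Qed.

Lemma sradius_point z : sradius (z *: e0 + e2) = 1.
Proof. by rewrite sradiusE !sdot_units !mulr0 !add0r sqrtr1. Qed.

Lemma space_point z : space_part (z *: e0 + e2) != 0.
Proof. by rewrite -sradius_gt0 sradius_point. Qed.

Lemma slit_point r z : 0 < r -> r < rho -> S (profile_point r z).
Proof.
move=> r0 rr; split; last exact: space_neq0 (space_point z).
by rewrite /cylinder /= -/(sradius (r *: e1)) sradius_e1.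
Qed.

Lemma derive_point_z (f : E * E -> R) r z :
  derive1 (fun z => f (profile_point r z)) z = 'D_((0 : E, e0)) f (profile_point r z).
Proof.
rewrite derive1E; apply: (@derive_affine _ _ _ (profile_point r) f) => h.
by congr pair; rewrite /= ?scaler0 ?add0r// [h%:A]mulr1 scalerDl addrA.
Qed.

Lemma is_derive_point_r k (f : E * E -> R) r z : Ck k S f -> 0 < r -> r < rho ->
  is_derive r (1 : R) (fun r => f (profile_point r z))
    ('D_((e1, 0 : E)) f (profile_point r z)).
Proof.
move=> cf r0 rr.
apply: (@is_derive_affine R (E * E)%type R (fun r => profile_point r z) f r 1 (e1, 0)).
  move=> h; congr pair; first by rewrite /= [h%:A]mulr1 scalerDl.
  by rewrite /= scaler0 add0r.
by apply: (Ck_is_derive _ cf); exact: slit_point.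
Qed.

Lemma Ck_point k (f : E * E -> R) r : Ck k S f -> 0 < r -> r < rho ->
  Ck k setT (fun z => f (profile_point r z)).
Proof.
move=> cf r0 rr.
apply: (@Ck_affine R (E * E)%type R k S setT (profile_point r)
  (fun h => (0, h *: e0)) f) => //.
- exact: openT.
- move=> h w z; congr pair; rewrite /= ?scaler0 ?add0r//.
  by rewrite scalerDl scalerA addrA.
- by move=> z _; exact: slit_point.
Qed.

Lemma smooth_profile r : 0 < r -> r < rho -> forall k, Ck k setT (profile r).
Proof. by move=> r0 rr k; apply: Ck_point => //; exact: Ck_energy. Qed.

Lemma smooth_dprofile r : 0 < r -> r < rho -> forall k, Ck k setT (dprofile r).
Proof.
move=> r0 rr k; apply: (Ck_point (f := DX Eg)) => //.
exact: Ck_derive (Ck_energy hF k.+1).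
Qed.

Lemma is_derive_profile r z : 0 < r -> r < rho ->
  is_derive r (1 : R) (fun r => profile r z) (dprofile r z).
Proof. by move=> r0 rr; exact: (is_derive_point_r z (Ck_energy hF 0)). Qed.

Lemma profile1E r : derive1 (profile r) = fun z => DZ Eg (profile_point r z).
Proof. by apply/funext => z; exact: (derive_point_z Eg). Qed.

Lemma profile2E r : derive1 (derive1 (profile r)) =
  fun z => DZ (DZ Eg) (profile_point r z).
Proof.
apply/funext => z; rewrite -(derive_point_z (DZ Eg)).
exact: (congr1 (fun g : R -> R => derive1 g z) (profile1E r)).
Qed.

Lemma dprofile1E r : derive1 (dprofile r) =
  fun z => DZ (DX Eg) (profile_point r z).
Proof. by apply/funext => z; exact: (derive_point_z (DX Eg)). Qed.

Lemma dprofile2E r : derive1 (derive1 (dprofile r)) =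
  fun z => DZ (DZ (DX Eg)) (profile_point r z).
Proof.
apply/funext => z; rewrite -(derive_point_z (DZ (DX Eg))).
exact: (congr1 (fun g : R -> R => derive1 g z) (dprofile1E r)).
Qed.

(** The derivatives in the slope and in the radius commute. *)
Lemma is_derive_profile1 r z : 0 < r -> r < rho ->
  is_derive r (1 : R) (fun r => derive1 (profile r) z) (derive1 (dprofile r) z).
Proof.
move=> r0 rr.
have := is_derive_point_r z (Ck_derive (0 : E, e0) (Ck_energy hF 1)) r0 rr.
have sw := derive_swap (0 : E, e0) (e1, 0 : E) oS (slit_point z r0 rr) (Ck_energy hF 2).
move=> /is_derive_eq/(_ (etrans sw (congr1 (fun g : R -> R => g z)
  (esym (dprofile1E r))))) h.
exact: (is_derive_eq_open openT I
  (fun s _ => congr1 (fun g : R -> R => g z) (esym (profile1E s))) h).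
Qed.

Lemma is_derive_profile2 r z : 0 < r -> r < rho ->
  is_derive r (1 : R) (fun r => derive1 (derive1 (profile r)) z)
    (derive1 (derive1 (dprofile r)) z).
Proof.
move=> r0 rr.
have := is_derive_point_r z
  (Ck_derive (0 : E, e0) (Ck_derive (0 : E, e0) (Ck_energy hF 2))) r0 rr.
have sw := derive_swap (0 : E, e0) (e1, 0 : E) oS (slit_point z r0 rr)
  (Ck_derive (0 : E, e0) (Ck_energy hF 3)).
have sw' := derive_eq_open (0 : E, e0) oS (slit_point z r0 rr)
  (fun p Sp => derive_swap (0 : E, e0) (e1, 0 : E) oS Sp (Ck_energy hF 2)).
move=> /is_derive_eq/(_ (etrans sw (etrans sw' (congr1 (fun g : R -> R => g z)
  (esym (dprofile2E r)))))) h.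
exact: (is_derive_eq_open openT I
  (fun s _ => congr1 (fun g : R -> R => g z) (esym (profile2E s))) h).
Qed.

(** ** First and second derivatives *)

Hypothesis radial : forall x y : E, cylinder rho x ->
  space_part x != 0 -> space_part y != 0 ->
  F x y = sradius y * F (sradius x *: e1) ((time_part y / sradius y) *: e0 + e2).

Local Notation slope y := (time_part y / sradius y).

Section AtPoint.
Variables (x y : E).
Hypotheses (cx : cylinder rho x) (x0 : space_part x != 0) (y0 : space_part y != 0).

Lemma energy_profile : energy F x y = sradius y ^+ 2 * profile (sradius x) (slope y).
Proof. by rewrite /energy radial// exprMn. Qed.

Lemma sradius_x_gt0 : 0 < sradius x. Proof. by rewrite sradius_gt0. Qed.

Lemma sradius_x_lt : sradius x < rho. Proof. exact: cx. Qed.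

Lemma sradius_y_neq0 : sradius y != 0. Proof. by rewrite gt_eqF// sradius_gt0. Qed.

Lemma is_derive_slope v :
  is_derive y v (fun y => slope y)
    ((time_part v - slope y * (sdot y v / sradius y)) / sradius y).
Proof.
apply: (is_derive_eq (is_derive_divf (is_derive_time y v) (is_derive_radius v y0)
  sradius_y_neq0)).
by field; exact: sradius_y_neq0.
Qed.

(** The first and second derivatives of the energy, as forms in arbitrary
    directions: [v] and [w] are directions for [y], except for the last
    argument of the two forms [energy_dx_grad] and [energy_dx], which is a
    direction for [x]. *)
Definition energy_grad v : R :=
  sradius y * derive1 (profile (sradius x)) (slope y) * time_part v +
  transverse (profile (sradius x)) (slope y) * sdot y v.

Definition energy_hess v w : R :=
  derive1 (derive1 (profile (sradius x))) (slope y) * time_part v * time_part w +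
  mixed (profile (sradius x)) (slope y) *
    (time_part v * sdot y w + time_part w * sdot y v) / sradius y +
  transverse (profile (sradius x)) (slope y) * sdot v w -
  slope y * mixed (profile (sradius x)) (slope y) * sdot y v * sdot y w / sradius y ^+ 2.

Definition energy_dx_grad v w : R :=
  (sradius y * derive1 (dprofile (sradius x)) (slope y) * time_part v +
   (2 * dprofile (sradius x) (slope y) - slope y * derive1 (dprofile (sradius x)) (slope y))
     * sdot y v) * (sdot x w / sradius x).

Definition energy_dx w : R :=
  sradius y ^+ 2 * dprofile (sradius x) (slope y) * (sdot x w / sradius x).

End AtPoint.

Let profileC x (cx : cylinder rho x) (x0 : space_part x != 0) k :=
  smooth_profile (sradius_x_gt0 x0) (sradius_x_lt cx) k.

Lemma is_derive_energy x y v : cylinder rho x -> space_part x != 0 ->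
  space_part y != 0 -> is_derive y v (energy F x) (energy_grad x y v).
Proof.
move=> cx x0 y0.
apply: (is_derive_eq_open (@open_space R n) y0 (f := fun y =>
  sradius y ^+ 2 * profile (sradius x) (slope y))).
  by move=> y' y'0; rewrite energy_profile.
apply: (is_derive_eq (is_derive_mulf (is_derive_expf (is_derive_radius v y0) 1)
  (is_derive_chain (is_derive_slope y0 v) (smooth_is_derive1 _ (profileC cx x0))))).
rewrite /energy_grad /transverse; have := sradius_y_neq0 y0 => r0.
by field.
Qed.

Lemma is_derive_energy2 x y v w : cylinder rho x -> space_part x != 0 ->
  space_part y != 0 -> is_derive y w (fun y => 'D_v (energy F x) y) (energy_hess x y v w).
Proof.
move=> cx x0 y0; have r0 := sradius_y_neq0 y0.
apply: (is_derive_eq_open (@open_space R n) y0 (f := fun y => energy_grad x y v)).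
  by move=> y' y'0; apply/esym/derive_val; exact: is_derive_energy.
have dz := is_derive_slope y0 w; have s1 := smooth_derive1 (profileC cx x0).
apply: (is_derive_eq (is_derive_addf
  (is_derive_mulf (is_derive_mulf (is_derive_radius w y0)
     (is_derive_chain dz (smooth_is_derive1 _ s1))) (is_derive_cstf y w (time_part v)))
  (is_derive_mulf (is_derive_chain dz (is_derive_transverse (profileC cx x0) _))
     (is_derive_sdot y w v)))).
rewrite /energy_hess /mixed (sdotC w v).
by field.
Qed.

Lemma is_derive_energy_x x y w : cylinder rho x -> space_part x != 0 ->
  space_part y != 0 -> is_derive x w (fun x => energy F x y) (energy_dx x y w).
Proof.
move=> cx x0 y0.
have oU : open (cylinder rho `&` [set x : E | space_part x != 0]).
  by apply: openI; [exact: open_cylinder|exact: open_space].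
apply: (is_derive_eq_open oU (conj cx x0) (f := fun x =>
  sradius y ^+ 2 * profile (sradius x) (slope y))).
  by move=> x' [cx' x'0]; rewrite energy_profile.
have dp := is_derive_profile (slope y) (sradius_x_gt0 x0) (sradius_x_lt cx).
apply: (is_derive_eq (is_derive_cmulf
  (is_derive_chain (is_derive_radius w x0) dp) (sradius y ^+ 2))).
by rewrite mulrA.
Qed.

Lemma is_derive_energy_xy x y v w : cylinder rho x -> space_part x != 0 ->
  space_part y != 0 ->
  is_derive x w (fun x => 'D_v (energy F x) y) (energy_dx_grad x y v w).
Proof.
move=> cx x0 y0.
have oU : open (cylinder rho `&` [set x : E | space_part x != 0]).
  by apply: openI; [exact: open_cylinder|exact: open_space].
apply: (is_derive_eq_open oU (conj cx x0) (f := fun x => energy_grad x y v)).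
  by move=> x' [cx' x'0]; apply/esym/derive_val; exact: is_derive_energy.
have rx := sradius_x_gt0 x0; have rr := sradius_x_lt cx.
have dp := is_derive_profile (slope y) rx rr.
have dp1 := is_derive_profile1 (slope y) rx rr.
have dr := is_derive_radius w x0.
have dM := is_derive_subf (is_derive_cmulf dp 2) (is_derive_cmulf dp1 (slope y)).
apply: (is_derive_eq (is_derive_addf
  (is_derive_mulf (is_derive_cmulf (is_derive_chain dr dp1) (sradius y))
     (is_derive_cstf x w (time_part v)))
  (is_derive_mulf (is_derive_chain dr dM) (is_derive_cstf x w (sdot y v))))).
by rewrite /energy_dx_grad; ring.
Qed.

Lemma energy_hess_sum x y v (H : E) :
  \sum_B energy_hess x y v (unit_vec R B) * H 0 B = energy_hess x y v H.
Proof.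
have e B : energy_hess x y v (unit_vec R B) * H 0 B =
  (derive1 (derive1 (profile (sradius x))) (slope y) * time_part v +
   mixed (profile (sradius x)) (slope y) * sdot y v / sradius y) *
      (H 0 B * time_part (unit_vec R B)) +
  (mixed (profile (sradius x)) (slope y) * time_part v / sradius y -
   slope y * mixed (profile (sradius x)) (slope y) * sdot y v / sradius y ^+ 2) *
      (H 0 B * sdot y (unit_vec R B)) +
  transverse (profile (sradius x)) (slope y) * (H 0 B * sdot v (unit_vec R B)).
  by rewrite /energy_hess; ring.
rewrite (eq_bigr _ (fun B _ => e B)) !big_split -!mulr_sumr.
by rewrite time_sum !sdot_sum /energy_hess /=; ring.
Qed.

Lemma energy_hessC x y v w : energy_hess x y v w = energy_hess x y w v.
Proof. by rewrite /energy_hess (sdotC v w); ring. Qed.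

Lemma quad_form_hess x y v : cylinder rho x -> space_part x != 0 ->
  space_part y != 0 ->
  quad_form (fundamental_tensor (F x) y) v = 2^-1 * energy_hess x y v v.
Proof.
move=> cx x0 y0.
rewrite -(energy_hess_sum x y v v) mulr_sumr; apply: eq_bigr => A _.
rewrite energy_hessC -(energy_hess_sum x y (unit_vec R A) v) mulr_suml mulr_sumr.
apply: eq_bigr => B _.
rewrite fundamental_tensorE (_ : d_y B _ x y = energy_hess x y (unit_vec R A) (unit_vec R B)).
  by ring.
by apply: derive_val; exact: is_derive_energy2.
Qed.

(** ** Strong convexity of the profile *)

Section Convexity.
Variables (r z : R).
Hypotheses (r0 : 0 < r) (rr : r < rho).

Let hess_gt0 v : v != 0 -> 0 < energy_hess (r *: e1) (z *: e0 + e2) v v.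
Proof.
move=> v0; have [cp yp] := slit_point z r0 rr.
have x0 : space_part (r *: e1) != 0 by rewrite -sradius_gt0 sradius_e1.
have [_ _ _ pd] := hF.2 (r *: e1) cp.
have := pd _ yp v v0; rewrite quad_form_hess ?space_point//.
by rewrite pmulr_rgt0// invr_gt0.
Qed.

Let hessE v : energy_hess (r *: e1) (z *: e0 + e2) v v =
  derive1 (derive1 (profile r)) z * time_part v ^+ 2 +
  2 * mixed (profile r) z * time_part v * sdot e2 v +
  transverse (profile r) z * sdot v v - z * mixed (profile r) z * sdot e2 v ^+ 2.
Proof.
rewrite /energy_hess sradius_e1// sradius_point !sdot_units !time_units.
by rewrite ?mulr0 ?add0r !mulr1 addr0 expr1n !divr1; ring.
Qed.

Lemma profile2_gt0 : 0 < derive1 (derive1 (profile r)) z.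
Proof.
have v0 : e0 != 0.
  apply/eqP => /(congr1 (@time_part R n)); rewrite time_unit0 /time_part mxE => /eqP.
  by rewrite oner_eq0.
have := hess_gt0 v0; rewrite hessE !sdot_units time_unit0.
by rewrite expr1n !mulr1 !mulr0 expr0n mulr0 subr0 !addr0.
Qed.

Lemma transverse_gt0 : 0 < transverse (profile r) z.
Proof.
have v0 : e1 != 0 by apply: space_neq0; rewrite -sradius_gt0 sradiusE e1_e1 sqrtr1.
have := hess_gt0 v0; rewrite hessE !sdot_units time_unitS.
by rewrite [X in 0 < X](_ : _ = transverse (profile r) z)//; ring.
Qed.

Lemma planar_det_gt0 : 0 < planar_det (profile r) z.
Proof.
have P0 := profile2_gt0.
set p2 := derive1 (derive1 (profile r)) z in P0.
(* The value of the Hessian on [v] is [p2] times [planar_det]. *)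
pose v : E := (- mixed (profile r) z) *: e0 + p2 *: e2.
have v0 : v != 0.
  apply: space_neq0; rewrite -sradius_gt0 sradiusE sqrtr_gt0 !sdot_units.
  by rewrite !mulr0 !add0r mulr1 mulr_gt0.
have := hess_gt0 v0; rewrite hessE !sdot_units !time_units -/p2.
rewrite [X in 0 < X](_ : _ = p2 * planar_det (profile r) z) ?pmulr_rgt0//.
rewrite /planar_det /transverse /mixed -/p2; ring.
Qed.

End Convexity.

(** * The spray *)

Definition spatial (w : E) : E := w - time_part w *: e0.

Lemma time_spatial w : time_part (spatial w) = 0.
Proof. by rewrite /spatial -scaleNr !time_units; ring. Qed.

Lemma sdot_spatial v w : sdot v (spatial w) = sdot v w.
Proof. by rewrite /spatial -scaleNr !sdot_units mulr0 addr0. Qed.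

(** The geodesic equations decouple: their component orthogonal to [y] gives
    the coefficient of [x], and the two equations in the plane of [e0] and
    the spatial part of [y] give the two rates. *)
Definition spray_vec (x y : E) : E :=
  (sdot x y / sradius x * sradius y *
     time_rate (profile (sradius x)) (dprofile (sradius x)) (slope y)) *: e0 +
  (- (sradius y ^+ 2 / (2 * sradius x)) *
     (dprofile (sradius x) (slope y) / transverse (profile (sradius x)) (slope y)))
    *: spatial x +
  (sdot x y / sradius x *
     space_rate (profile (sradius x)) (dprofile (sradius x)) (slope y)) *: spatial y.

Lemma spray_vec_time x y : spray_vec x y 0 ord0 =
  sdot x y / sradius x * sradius y *
    time_rate (profile (sradius x)) (dprofile (sradius x)) (slope y).
Proof.
rewrite -[LHS]/(time_part (spray_vec x y)) /spray_vec.
by rewrite !(time_spatial, time_units); ring.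
Qed.

Lemma spray_vec_space x y i : spray_vec x y 0 (lift ord0 i) =
  - (sradius y ^+ 2 / (2 * sradius x)) *
     (dprofile (sradius x) (slope y) / transverse (profile (sradius x)) (slope y))
    * x 0 (lift ord0 i) +
  sdot x y / sradius x *
     space_rate (profile (sradius x)) (dprofile (sradius x)) (slope y) * y 0 (lift ord0 i).
Proof. by rewrite /spray_vec /spatial !mxE /= !mulr0 !subr0 add0r. Qed.

Lemma geodesic_equations x y v : cylinder rho x -> space_part x != 0 ->
  space_part y != 0 ->
  2 * energy_hess x y v (spray_vec x y) = energy_dx_grad x y v y - energy_dx x y v.
Proof.
move=> cx x0 y0.
have r0 := sradius_x_gt0 x0; have rr := sradius_x_lt cx.
have M0 := transverse_gt0 (slope y) r0 rr.
have D0 := planar_det_gt0 (slope y) r0 rr.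
have b0 := sradius_y_neq0 y0.
have sH w : sdot w (spray_vec x y) =
  - (sradius y ^+ 2 / (2 * sradius x)) *
     (dprofile (sradius x) (slope y) / transverse (profile (sradius x)) (slope y))
    * sdot x w +
  sdot x y / sradius x *
     space_rate (profile (sradius x)) (dprofile (sradius x)) (slope y) * sdot y w.
  by rewrite /spray_vec !(sdot_spatial, sdot_units) (sdotC w x) (sdotC w y) mulr0 add0r.
have tH : time_part (spray_vec x y) = _ := spray_vec_time x y.
rewrite /energy_hess /energy_dx_grad /energy_dx tH !sH -(sradius_sq y).
rewrite /space_rate /time_rate; move: M0 D0 b0 (lt0r_neq0 r0).
rewrite /transverse /mixed /planar_det.
move: (derive1 (derive1 (profile (sradius x))) (slope y)) => p2.
move: (derive1 (profile (sradius x)) (slope y)) => p1.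
move: (derive1 (dprofile (sradius x)) (slope y)) => q1.
move: (profile (sradius x) (slope y)) (dprofile (sradius x) (slope y)) => p q.
move: (slope y) => z; move: (sradius y) (sradius x) (sdot x y) => b r s.
move: (time_part v) (sdot x v) (sdot y v) => v0 xv yv.
move=> /lt0r_neq0 M0 /lt0r_neq0 D0 b0 {}r0.
by field; rewrite M0 D0 b0 r0.
Qed.

Lemma spray_formula x y C : cylinder rho x -> space_part x != 0 ->
  space_part y != 0 -> spray F C x y = spray_vec x y 0 C.
Proof.
move=> cx x0 y0; apply: (spray_unique hF) => [|A].
  by split=> //; exact: space_neq0.
rewrite (eq_bigr (fun B => 2 * (energy_hess x y (unit_vec R A) (unit_vec R B) *
    spray_vec x y 0 B))) => [|B _]; last first.
  by rewrite mulrA; congr (_ * _ * _); apply: derive_val; exact: is_derive_energy2.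
rewrite -mulr_sumr energy_hess_sum geodesic_equations//; congr (_ - _); last first.
  by apply/esym/derive_val; exact: is_derive_energy_x.
rewrite {1}/energy_dx_grad -(sdot_sum x y) mulr_suml mulr_sumr.
apply: eq_bigr => B _.
rewrite (_ : d_x B _ x y = energy_dx_grad x y (unit_vec R A) (unit_vec R B)).
  by rewrite /energy_dx_grad; ring.
by apply: derive_val; exact: is_derive_energy_xy.
Qed.

(** ** The Landsberg tensor in the radial direction *)

Lemma line_point z t : sradius (z *: e0 + e2 + t *: e1) = Num.sqrt (1 + t ^+ 2).
Proof. by rewrite sradiusE !sdot_units; congr Num.sqrt; ring. Qed.

Lemma slope_line z t :
  slope (z *: e0 + e2 + t *: e1) = z / Num.sqrt (1 + t ^+ 2).
Proof. by rewrite line_point !time_units; congr (_ / _); ring. Qed.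

Section Landsberg.
Hypothesis landsberg : is_landsberg rho F.

Let rates_r r (r0 : 0 < r) (rr : r < rho) k :
    Ck k setT (time_rate (profile r) (dprofile r)) :=
  Ck_time_rate (smooth_profile r0 rr) (smooth_dprofile r0 rr)
    (fun z => planar_det_gt0 z r0 rr) k.

Let rates_s r (r0 : 0 < r) (rr : r < rho) k :
    Ck k setT (space_rate (profile r) (dprofile r)) :=
  Ck_space_rate (smooth_profile r0 rr) (smooth_dprofile r0 rr)
    (fun z => transverse_gt0 z r0 rr) (fun z => planar_det_gt0 z r0 rr) k.

(** On the line through [y] in the direction [e1] the components of the spray
    along [e0] and [e2] are [t * g (1 + t ^+ 2)], and the derivative of the
    energy at [y] vanishes in the other coordinate directions. *)
Lemma landsberg_rates r z : 0 < r -> r < rho ->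
  derive1 (profile r) z * (time_rate (profile r) (dprofile r) z -
     z * derive1 (time_rate (profile r) (dprofile r)) z) =
  transverse (profile r) z * (z * derive1 (space_rate (profile r) (dprofile r)) z).
Proof.
move=> r0 rr; set u := time_rate _ _; set v := space_rate _ _.
have du := smooth_is_derive1 z (rates_r r0 rr).
have dv := smooth_is_derive1 z (rates_s r0 rr).
have [cp yp] := slit_point z r0 rr.
have x0 : space_part (r *: e1) != 0 by rewrite -sradius_gt0 sradius_e1.
have pos (t : R) : 0 < 1 + t ^+ 2 by rewrite ltr_wpDr// sqr_ge0.
have yt0 t : space_part (z *: e0 + e2 + t *: e1) != 0.
  by rewrite -sradius_gt0 line_point sqrtr_gt0.
have st t : sdot (r *: e1) (z *: e0 + e2 + t *: e1) / sradius (r *: e1) = t.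
  by rewrite sradius_e1// !sdot_units; field; exact: lt0r_neq0.
have T0 : 'D_e1 (fun y => 'D_e1 (fun y => 'D_e1 (spray F ord0 (r *: e1)) y) y)
    (z *: e0 + e2) = 3 * (u z - z * derive1 u z).
  rewrite third_derivative_line.
  rewrite (@third_derivative_odd R (fun s => Num.sqrt s * u (z / Num.sqrt s))).
  - have ds : is_derive (1 : R) (1 : R) (@Num.sqrt R) (2 * Num.sqrt 1)^-1
      := is_derive1_sqrt ltr01.
    rewrite (@derive_val _ _ _ _ _ _ _
      (is_derive_mulf ds (is_derive_slope_of_square du))).
    by rewrite sqrtr1 divr1 -/u; field.
  - apply: CkM; [exact: open_gt|exact: Ck_sqrt|].
    by apply: Ck_slope_of_square; exact: rates_r.
  - move=> t; rewrite spray_formula// spray_vec_time st sradius_e1// slope_line line_point.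
    exact: (esym (mulrA _ _ _)).
have T2 : 'D_e1 (fun y => 'D_e1 (fun y => 'D_e1 (spray F (lift ord0 i2) (r *: e1)) y) y)
    (z *: e0 + e2) = - 3 * (z * derive1 v z).
  rewrite third_derivative_line.
  rewrite (@third_derivative_odd R (fun s => v (z / Num.sqrt s))).
  - rewrite (@derive_val _ _ _ _ _ _ _ (is_derive_slope_of_square dv)) -/v.
    by field.
  - by apply: Ck_slope_of_square; exact: rates_s.
  - move=> t; rewrite spray_formula// spray_vec_space st sradius_e1// slope_line.
    rewrite !mxE !(inj_eq lift_inj) eqxx /= (eq_sym i2) (negbTE i12).
    by rewrite eqxx mulr0n mulr1n -/v; ring.
have := landsberg (slit_point z r0 rr) (lift ord0 i1) (lift ord0 i1) (lift ord0 i1).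
rewrite /landsberg_tensor => /eqP; rewrite mulf_eq0 oppr_eq0 invr_eq0 pnatr_eq0 /=.
rewrite (eq_bigr (fun D => energy_grad (r *: e1) (z *: e0 + e2) (unit_vec R D) *
   'D_e1 (fun y => 'D_e1 (fun y => 'D_e1 (spray F D (r *: e1)) y) y) (z *: e0 + e2)));
  last first.
  move=> D _; congr (_ * _); apply: derive_val; apply: is_derive_energy => //.
  exact: space_point.
have gE w : energy_grad (r *: e1) (z *: e0 + e2) w =
    derive1 (profile r) z * time_part w + transverse (profile r) z * sdot e2 w.
  rewrite /energy_grad sradius_e1// sradius_point !sdot_units !time_units.
  by rewrite mulr0 add0r !mulr1 addr0 divr1 mul1r.
move=> /eqP h.
have {}h : derive1 (profile r) z * (3 * (u z - z * derive1 u z)) +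
    transverse (profile r) z * (- 3 * (z * derive1 v z)) = 0.
  rewrite -h big_ord_recl; congr (_ + _).
    rewrite gE time_unit0 sdot_unit0 mulr1 mulr0 addr0.
    by congr (_ * _); exact: esym T0.
  rewrite (bigD1 i2)//= big1 => [|i ii2]; last first.
    by rewrite gE time_unitS sdot_unitS mxE (inj_eq lift_inj) (negbTE ii2)
      !mulr0 addr0 mul0r.
  rewrite addr0 gE time_unitS e2_e2 mulr1 mulr0 add0r.
  by congr (_ * _); exact: esym T2.
apply/eqP; rewrite -subr_eq0; apply/eqP.
apply: (@mulfI _ 3); first by rewrite pnatr_eq0.
by rewrite mulr0 -[RHS]h; ring.
Qed.

Lemma Ck_point_r k (f : E * E -> R) z : Ck k S f ->
  Ck k [set r : R | 0 < r < rho] (fun r => f (profile_point r z)).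
Proof.
have oI := @open_between R 0 rho.
move=> cf; apply: (@Ck_affine R (E * E)%type R k S _ (fun r => profile_point r z)
  (fun h => (h *: e1, 0)) f) => //.
- move=> h w r; congr pair; rewrite /= ?scaler0 ?add0r//.
  by rewrite scalerDl scalerA.
- by move=> r /andP[r0 rr]; exact: slit_point.
Qed.

Lemma continuous_time_rate_r r z : 0 < r -> r < rho ->
  {for r, continuous (fun r => time_rate (profile r) (dprofile r) z)}.
Proof.
move=> r0 rr.
have oI := @open_between R 0 rho.
have c0 := Ck_point_r z (Ck_energy hF 0).
have c1 : Ck 0 [set r : R | 0 < r < rho] (fun r => derive1 (profile r) z).
  apply: (eq_Ck oI _ (Ck_point_r z (Ck_derive (0 : E, e0) (Ck_energy hF 1)))) => s _.
  exact: (congr1 (fun g : R -> R => g z) (esym (profile1E s))).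
have c2 : Ck 0 [set r : R | 0 < r < rho] (fun r => derive1 (derive1 (profile r)) z).
  apply: (eq_Ck oI _ (Ck_point_r z (Ck_derive (0 : E, e0)
    (Ck_derive (0 : E, e0) (Ck_energy hF 2))))) => s _.
  exact: (congr1 (fun g : R -> R => g z) (esym (profile2E s))).
have d0 := Ck_point_r z (Ck_derive (e1, 0 : E) (Ck_energy hF 1)).
have d1 : Ck 0 [set r : R | 0 < r < rho] (fun r => derive1 (dprofile r) z).
  apply: (eq_Ck oI _ (Ck_point_r z (Ck_derive (0 : E, e0)
    (Ck_derive (e1, 0 : E) (Ck_energy hF 2))))) => s _.
  exact: (congr1 (fun g : R -> R => g z) (esym (dprofile1E s))).
have cc c := Ck_cst oI 0 c.
apply: (Ck_continuous (k := 0) (U := [set r : R | 0 < r < rho])); last first.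
  by rewrite /= r0 rr.
have cM := CkB oI (CkM oI (cc 2) c0) (CkM oI (cc z) c1).
have cX := CkB oI c1 (CkM oI (cc z) c2).
have cD := CkB oI (CkM oI (CkM oI (cc 2) c0) c2) (CkX oI 2 c1).
apply: (CkM oI (CkB oI (CkM oI d1 cM) (CkM oI d0 cX)) (CkV oI _ (CkM oI (cc 2) cD))).
move=> s /andP[s0 sr]; rewrite mulf_neq0 ?pnatr_eq0//.
by have /lt0r_neq0 := planar_det_gt0 z s0 sr.
Qed.

(** Where the time rate does not vanish it also does not for nearby slopes and
    nearby radii; there the mixed coefficient is zero, and so are both of its
    partial derivatives. *)
Lemma landsberg_linear r : 0 < r -> r < rho ->
  exists l v, [/\ forall z, time_rate (profile r) (dprofile r) z = l * z,
    forall z, space_rate (profile r) (dprofile r) z = v &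
    forall z, l * mixed (profile r) z = 0].
Proof.
move=> r0 rr.
have sq := smooth_dprofile r0 rr.
have D0 z := planar_det_gt0 z r0 rr.
have uchi s z : 0 < s -> s < rho ->
    time_rate (profile s) (dprofile s) z * mixed (profile s) z = 0.
  move=> s0 sr.
  exact: (landsberg_profile (smooth_profile s0 sr) (smooth_dprofile s0 sr)
    (fun t => transverse_gt0 t s0 sr) (fun t => profile2_gt0 t s0 sr)
    (fun t => planar_det_gt0 t s0 sr) (landsberg_rates z s0 sr)).
apply: (linear_rates (smooth_profile r0 rr) sq (fun z => transverse_gt0 z r0 rr) D0
  (fun z => uchi r z r0 rr)) => z u0.
have chi0 s t : 0 < s -> s < rho -> time_rate (profile s) (dprofile s) t != 0 ->
    mixed (profile s) t = 0.
  by move=> s0 sr /negbTE un0; have /eqP := uchi s t s0 sr;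
    rewrite mulf_eq0 un0 => /eqP.
have near0 (u : R -> R) (a : R) : {for a, continuous u} -> u a != 0 ->
    \forall s \near a, u s != 0.
  move=> cu ua; have e0 : 0 < `|u a| by rewrite normr_gt0.
  apply: filterS (continuous_near cu e0) => s /= us.
  by apply/eqP => us0; move: us; rewrite us0 subr0 ltxx.
have cz : {for z, continuous (time_rate (profile r) (dprofile r))}.
  by apply: (Ck_continuous (rates_r r0 rr 0)).
have near_z : \forall t \near z, mixed (profile r) t = cst 0 t.
  by apply: filterS (near0 _ _ cz u0) => t ut; exact: chi0.
have cr := continuous_time_rate_r (z := z) r0 rr.
have near_r : \forall s \near r, derive1 (profile s) z -
    z * derive1 (derive1 (profile s)) z = cst 0 s.
  have n1 : \forall s \near r, 0 < s by exact: lt_nbhsr.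
  have n2 : \forall s \near r, s < rho by exact: lt_nbhsl.
  apply: filterS3 (near0 _ _ cr u0) n1 n2 => s us s0 sr; exact: chi0.
have m0 : mixed (profile r) z = 0 := nbhs_singleton near_z.
have m1 : derive1 (mixed (profile r)) z = 0.
  by rewrite derive1E (near_eq_derive _ near_z) derive_cst.
have m2 : derive1 (dprofile r) z - z * derive1 (derive1 (dprofile r)) z = 0.
  have dchi := is_derive_subf (is_derive_profile1 z r0 rr)
    (is_derive_cmulf (is_derive_profile2 z r0 rr) z).
  exact: etrans (esym (@derive_val _ _ _ _ _ _ _ dchi))
    (etrans (near_eq_derive (1 : R) near_r) (derive_cst _ _ _)).
exact: (time_rate_homogeneous (smooth_profile r0 rr) sq D0 m0 m1 (subr0_eq m2)).
Qed.

End Landsberg.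

(** * From the rates to the Berwald condition *)

(** The velocity [(b * u, b * v)] is the diagonal linear map with entries [l]
    and [v], and [l] vanishes unless the norm is Euclidean. *)
Definition linear_at r l v := [/\ forall z, time_rate (profile r) (dprofile r) z = l * z,
    forall z, space_rate (profile r) (dprofile r) z = v &
    forall z, l * mixed (profile r) z = 0].

Lemma mixed0_profile r : 0 < r -> r < rho -> (forall z, mixed (profile r) z = 0) ->
  exists a c, [/\ 0 < a, forall z, profile r z = a + c * z ^+ 2 &
    forall z, derive1 (profile r) z = 2 * c * z].
Proof.
move=> r0 rr m0.
have [a [c pE]] := mixed0_quadratic (smooth_profile r0 rr) m0.
exists a, c; split=> //; last exact: derive1_quadratic.
have := transverse_gt0 0 r0 rr; rewrite /transverse pE mul0r subr0 expr0n mulr0 addr0.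
by rewrite pmulr_rgt0.
Qed.

(** A non-zero [l] makes the profile a quadratic polynomial, and then [p' / M]
    is linear; this is what keeps the coefficient of [x] quadratic in [y]. *)
Lemma linear_at_quadratic r l v : 0 < r -> r < rho -> linear_at r l v ->
  exists k, forall z,
    dprofile r z / transverse (profile r) z = v + k * z ^+ 2.
Proof.
move=> r0 rr [ul vv lm].
have M0 z := transverse_gt0 z r0 rr.
have kE z : dprofile r z / transverse (profile r) z =
    v + derive1 (profile r) z / transverse (profile r) z * (l * z).
  rewrite (rates (dprofile r) M0 z) vv ul; have := lt0r_neq0 (M0 z).
  by move: (transverse _ _) (derive1 _ _) => M p1 {}M0; field.
have [l0|l0] := eqVneq l 0.
  by exists 0 => z; rewrite kE l0 !mul0r mulr0.
have m0 z : mixed (profile r) z = 0.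
  by have /eqP := lm z; rewrite mulf_eq0 (negbTE l0) => /eqP.
have [a [c [a0 pE p1E]]] := mixed0_profile r0 rr m0.
exists (c / a * l) => z; rewrite kE /transverse p1E pE; congr (_ + _).
rewrite (_ : 2 * (a + c * z ^+ 2) - z * (2 * c * z) = 2 * a); last by ring.
by field; exact: lt0r_neq0.
Qed.

(** A quadratic function is recognised by its derivatives: the first one is
    differentiable with a constant derivative. *)
Definition quadratic (f : E -> R) := exists B C : E -> E -> R,
  (forall y v, is_derive y v f (B y v)) /\
  (forall y v w, is_derive y w (fun y => B y v) (C v w)).

Lemma quadraticD f g : quadratic f -> quadratic g -> quadratic (fun y => f y + g y).
Proof.
move=> [B [C [dB dC]]] [B' [C' [dB' dC']]].
exists (fun y v => B y v + B' y v), (fun v w => C v w + C' v w).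
by split=> *; exact: is_derive_addf.
Qed.

Lemma quadraticZ c f : quadratic f -> quadratic (fun y => c * f y).
Proof.
move=> [B [C [dB dC]]]; exists (fun y v => c * B y v), (fun v w => c * C v w).
by split=> *; exact: is_derive_cmulf.
Qed.

Lemma quadraticM (f g : E -> R) :
  (forall y v, is_derive y v f (f v)) -> (forall y v, is_derive y v g (g v)) ->
  quadratic (fun y => f y * g y).
Proof.
move=> df dg; exists (fun y v => f y * g v + g y * f v),
  (fun v w => f w * g v + g w * f v); split=> [y v|y v w].
  exact: (is_derive_mulf (df y v) (dg y v)).
apply: (is_derive_eq (is_derive_addf
  (is_derive_mulf (df y w) (is_derive_cstf y w (g v)))
  (is_derive_mulf (dg y w) (is_derive_cstf y w (f v))))).
ring.
Qed.

Lemma quadratic_sdot : quadratic (fun y => sdot y y).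
Proof.
exists (fun y v => 2 * sdot y v), (fun v w => 2 * sdot w v).
split=> [y v|y v w]; first exact: is_derive_sdot_self.
exact: (is_derive_cmulf (is_derive_sdot y w v)).
Qed.

Lemma quadratic_third (U : set E) (f g : E -> R) (a b c y : E) :
  open U -> U y -> (forall y, U y -> f y = g y) -> quadratic g ->
  'D_c (fun y => 'D_b (fun y => 'D_a f y) y) y = 0.
Proof.
move=> oU Uy fg [B [C [dB dC]]].
have eB z : U z -> 'D_a f z = B z a.
  by move=> Uz; rewrite (derive_eq_open a oU Uz fg); exact: derive_val.
have eC z : U z -> 'D_b (fun y => 'D_a f y) z = C a b.
  by move=> Uz; rewrite (derive_eq_open b oU Uz eB); exact: derive_val.
by rewrite (derive_eq_open c oU Uy eC) derive_cst.
Qed.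

Lemma spray_quadratic x A : cylinder rho x -> space_part x != 0 ->
  (exists l v, linear_at (sradius x) l v) ->
  exists2 g, quadratic g & forall y, space_part y != 0 -> spray F A x y = g y.
Proof.
move=> cx x0 [l [v lv]].
have r0 := sradius_x_gt0 x0; have rr := sradius_x_lt cx.
have [k kE] := linear_at_quadratic r0 rr lv.
have [ul vv lm] := lv.
have dt := @is_derive_time R n.
have ds y w : is_derive y w (fun y => sdot y x) (sdot w x) by exact: is_derive_sdot.
have [i ->|->] := unliftP ord0 A.
- exists (fun y => - (x 0 (lift ord0 i) / (2 * sradius x)) *
     (v * sdot y y + k * (time_part y * time_part y)) +
     v / sradius x * (sdot y x * y 0 (lift ord0 i))).
    apply: quadraticD; apply: quadraticZ; last first.
      by apply: quadraticM => // y w; exact: is_derive_coord.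
    apply: quadraticD; apply: quadraticZ; first exact: quadratic_sdot.
    exact: quadraticM.
  move=> y y0; rewrite spray_formula// spray_vec_space vv kE -sradius_sq (sdotC y x).
  have b0 := sradius_y_neq0 y0; have {}r0 := lt0r_neq0 r0.
  move: (sradius y) (sradius x) b0 r0 => b r b0 r0.
  by field; rewrite b0 r0.
- exists (fun y => l / sradius x * (sdot y x * time_part y)).
    by apply: quadraticZ; apply: quadraticM.
  move=> y y0; rewrite spray_formula// spray_vec_time ul (sdotC y x).
  have b0 := sradius_y_neq0 y0; have {}r0 := lt0r_neq0 r0.
  move: (sradius y) (sradius x) b0 r0 => b r b0 r0.
  by field; rewrite b0 r0.
Qed.

(** The points with vanishing spatial part of [x] or [y] are limits of others:
    move both along [e1], away from zero. *)
Lemma slit_density (A : E * E -> R) (p : E * E) :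
  S p -> {for p, continuous A} ->
  (forall x y, S (x, y) -> space_part x != 0 -> space_part y != 0 -> A (x, y) = 0) ->
  A p = 0.
Proof.
case: p => x y Sp cA A0.
apply: (continuous_eq_nearby cA (B := fun=> 0)); first exact: cst_continuous.
move=> d' d'0.
have nS : nbhs (x, y) (S `&` ball (x, y) d').
  by apply: filterI; [exact: (open_nbhs_nbhs (conj oS Sp))|exact: nbhsx_ballx].
move/nbhs_ballP: nS => [d /= d0 dN].
pose eta := d / (2 * (`|e1| + 1)).
have s0 : 0 < `|e1| + 1 by rewrite ltr_wpDl.
have eta0 : 0 < eta by rewrite divr_gt0// mulr_gt0.
have etad : eta * `|e1| < d.
  apply: (@lt_le_trans _ _ (eta * (`|e1| + 1))); first by rewrite ltr_pM2l// ltrDl.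
  by rewrite /eta invfM mulrA divfK ?gt_eqF// ltW// gtr_pMr// invf_lt1// ltr1n.
have shift (w : E) : exists2 t : R, `|t| = eta & space_part (w + t *: e1) != 0.
  have ns t : w 0 (lift ord0 i1) + t != 0 -> space_part (w + t *: e1) != 0.
    apply: contraNneq => /rowP/(_ i1); rewrite !mxE !eqxx /= mulr1.
    by move=> ->.
  have [w0|w0] := leP 0 (w 0 (lift ord0 i1)).
    exists eta; first by rewrite gtr0_norm.
    by apply: ns; rewrite gt_eqF// ltr_wpDl.
  exists (- eta); first by rewrite normrN gtr0_norm.
  by apply: ns; rewrite lt_eqF// -oppr_gt0 opprD opprK addr_gt0// oppr_gt0.
have [s se xs] := shift x; have [t te yt] := shift y.
have bst : ball (x, y) d (x + s *: e1, y + t *: e1).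
  by split; rewrite -ball_normE /= opprD addNKr normrN normrZ ?se ?te.
have [Sst bd] := dN _ bst.
by exists (x + s *: e1, y + t *: e1), (x + s *: e1, y + t *: e1); split=> //; exact: A0.
Qed.

Lemma linear_berwald :
  (forall r, 0 < r -> r < rho -> exists l v, linear_at r l v) -> is_berwald rho F.
Proof.
move=> hl x y Sxy A B C D.
apply: (@slit_density (on_pairs (berwald_tensor F A B C D)) (x, y)) => //.
  exact: (Ck_continuous (Ck_berwald hF 0 A B C D) Sxy).
move=> {x y Sxy} x y [cx _] x0 y0.
have [g qg gE] := spray_quadratic A cx x0 (hl _ (sradius_x_gt0 x0) (sradius_x_lt cx)).
exact: (quadratic_third _ _ _ (@open_space R n) y0 gE qg).
Qed.

Lemma landsberg_berwald : is_landsberg rho F -> is_berwald rho F.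
Proof.
by move=> hL; apply: linear_berwald => r r0 rr; exact: landsberg_linear.
Qed.

(** * The classification *)

Section Classification.
Hypothesis rates_linear : forall r, 0 < r -> r < rho -> exists l v, linear_at r l v.

Local Notation level r := (profile r 0).
Local Notation bend r := (derive1 (derive1 (profile r)) 0).

Lemma level_gt0 r : 0 < r -> r < rho -> 0 < level r.
Proof.
move=> r0 rr; exact: (profile_gt0 (fun z => profile2_gt0 z r0 rr)
  (fun z => planar_det_gt0 z r0 rr)).
Qed.

(** The first order equation that moves the profile from radius to radius. *)
Lemma profile_equation r l v z : 0 < r -> r < rho -> linear_at r l v ->
  dprofile r z = v * transverse (profile r) z + l * (z * derive1 (profile r) z).
Proof.
move=> r0 rr [ul vv _].
rewrite (rates (dprofile r) (fun z => transverse_gt0 z r0 rr) z) ul vv.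
by move: (transverse _ _) (derive1 _ _) => M p1; ring.
Qed.

Lemma is_derive_level r l v : 0 < r -> r < rho -> linear_at r l v ->
  is_derive r (1 : R) (fun r => level r) (2 * v * level r).
Proof.
move=> r0 rr lv; apply: (is_derive_eq (is_derive_profile 0 r0 rr)).
rewrite (profile_equation 0 r0 rr lv) /transverse !mul0r mulr0 addr0 subr0.
by rewrite mulrCA mulrA.
Qed.

Lemma is_derive_bend r l v : 0 < r -> r < rho -> linear_at r l v ->
  is_derive r (1 : R) (fun r => bend r) (2 * l * bend r).
Proof.
move=> r0 rr lv; apply: (is_derive_eq (is_derive_profile2 0 r0 rr)).
have spr := smooth_profile r0 rr; have s1 := smooth_derive1 spr.
have s2 := smooth_derive1 s1.
have dqE : derive1 (dprofile r) = fun z => v * mixed (profile r) z +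
    l * (z * derive1 (derive1 (profile r)) z + derive1 (profile r) z).
  rewrite (funext (fun z => profile_equation z r0 rr lv)).
  apply/funext => z; rewrite derive1E; apply: derive_val.
  apply: (is_derive_eq (is_derive_addf (is_derive_cmulf (is_derive_transverse spr z) v)
    (is_derive_cmulf (is_derive_mulf (is_derive_idR z) (smooth_is_derive1 z s1)) l))).
  by rewrite mulr1.
rewrite dqE derive1E; apply: derive_val.
have d2 := smooth_is_derive1 0 s2; have d1 := smooth_is_derive1 0 s1.
apply: (is_derive_eq (is_derive_addf (is_derive_cmulf (is_derive_mixed spr 0) v)
  (is_derive_cmulf (is_derive_addf (is_derive_mulf (is_derive_idR 0) d2) d1) l))).
by rewrite !mul0r oppr0 mulr0 !add0r mulr1; ring.
Qed.

(** This is applied to the slope that follows the diagonal flow; it needs the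
    energy to be differentiable in the radius and the slope jointly. *)
Lemma is_derive_curve (zeta : R -> R) (r dz : R) : 0 < r -> r < rho ->
  is_derive r (1 : R) zeta dz ->
  is_derive r (1 : R) (fun r => profile r (zeta r))
    (dprofile r (zeta r) + dz * derive1 (profile r) (zeta r)).
Proof.
move=> r0 rr hz; have [/derivable1_diffP zd zE] := hz.
pose gam (s : R) : E * E := profile_point s (zeta s).
have dE : differentiable Eg (gam r).
  exact: (Ck_differentiable (Ck_energy hF 0) (slit_point _ r0 rr)).
have d1 : is_diff r (fun s : R => s *: e1) (fun h : R => h *: e1) := is_diff_scalel r e1.
have dzeta : is_diff r zeta (fun h => h * dz).
  by split=> //; rewrite diff1E// derive1E zE.
have d2 : is_diff r (fun s : R => zeta s *: e0) (fun h : R => (h * dz) *: e0).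
  exact: (is_diff_comp dzeta (is_diff_scalel (zeta r) e0)).
have d3 : is_diff r (fun s : R => zeta s *: e0 + e2) (fun h : R => (h * dz) *: e0 + 0).
  exact: (is_diffD d2 (is_diff_cst e2 r)).
have dg : is_diff r gam (fun h : R => (h *: e1, (h * dz) *: e0 + 0)).
  exact: (is_diff_pair d1 d3).
have [gd gE] := dg.
have dc : differentiable (fun s => Eg (gam s)) r.
  exact: (@differentiable_comp _ _ _ _ gam Eg).
have dd : is_derive r (1 : R) (fun r => profile r (zeta r))
    ('D_(1 : R) (fun s => Eg (gam s)) r).
  by apply: derivableP; exact: diff_derivable.
apply: (is_derive_eq dd).
rewrite deriveE// (@diff_comp _ _ _ _ gam Eg)//= gE.
rewrite -[dprofile _ _]/('D_((e1, 0 : E)) Eg (gam r)) (deriveE _ dE).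
rewrite (derive_point_z Eg) (deriveE _ dE) -[dz * _]linearZ -linearD.
by congr ('d _ _ _); congr pair; rewrite /= ?scale1r ?mul1r ?scaler0 ?addr0 ?add0r.
Qed.

(** The square roots of [level] and [bend] solve the equations for the two
    entries of the diagonal flow ([is_derive_level], [is_derive_bend]), so
    rescaling both variables by them undoes the flow. *)
Lemma scale_invariant r z : 0 < r -> r < rho ->
  is_derive r (1 : R) (fun r => profile r (z * Num.sqrt (level r / bend r)) / level r) 0.
Proof.
move=> r0 rr; have [l [v lv]] := rates_linear r0 rr.
have d0 := level_gt0 r0 rr; have c0 := profile2_gt0 0 r0 rr.
have dd := is_derive_level r0 rr lv; have dc := is_derive_bend r0 rr lv.
have dq := is_derive_divf dd dc (lt0r_neq0 c0).
have q0 : 0 < level r / bend r by rewrite divr_gt0.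
have ds := is_derive_cmulf (is_derive_chain dq (is_derive1_sqrt q0)) z.
apply: (is_derive_eq (is_derive_divf (is_derive_curve r0 rr ds) dd (lt0r_neq0 d0))).
rewrite (profile_equation _ r0 rr lv) /transverse.
have s0 : Num.sqrt (level r / bend r) != 0 by rewrite gt_eqF// sqrtr_gt0.
have sE : Num.sqrt (level r / bend r) ^+ 2 = level r / bend r by rewrite sqr_sqrtr// ltW.
move: s0 sE; set s := Num.sqrt _ => s0 sE.
move: (derive1 (profile r) (z * s)) (profile r (z * s)) => p1 p.
move: sE (lt0r_neq0 d0) (lt0r_neq0 c0).
move: (bend r) (level r) => c d sE {}d0 {}c0.
have cE : c = d / s ^+ 2 by rewrite sE invf_div mulrCA divff// mulr1.
by rewrite cE; field; rewrite d0 s0.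
Qed.

Lemma ratio_eq (a b c d : R) : c != 0 -> a / c = b / d -> a = c / d * b.
Proof. by move=> c0 e; rewrite -[LHS](divfK c0) e; ring. Qed.

Lemma profile_similar r s z : 0 < r -> r < rho -> 0 < s -> s < rho ->
  profile r z = level r / level s *
    profile s (Num.sqrt (bend r / level r) * z / Num.sqrt (bend s / level s)).
Proof.
move=> r0 rr s0 sr.
have d0 := level_gt0 r0 rr; have c0 := profile2_gt0 0 r0 rr.
have inv t : 0 < t -> t < rho ->
    Num.sqrt (level t / bend t) = (Num.sqrt (bend t / level t))^-1.
  move=> t0 tr; have lt := ltW (level_gt0 t0 tr); have bt := ltW (profile2_gt0 0 t0 tr).
  by rewrite -(sqrtrV (divr_ge0 bt lt)) invf_div.
have q0 : Num.sqrt (bend r / level r) != 0.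
  by apply: lt0r_neq0; rewrite sqrtr_gt0; exact: (divr_gt0 c0 d0).
have cst := @derive0_cst R [set t : R | 0 < t < rho] (fun t =>
  profile t (Num.sqrt (bend r / level r) * z * Num.sqrt (level t / bend t)) / level t).
have {cst} :
  profile r (Num.sqrt (bend r / level r) * z * Num.sqrt (level r / bend r)) / level r
  = profile s (Num.sqrt (bend r / level r) * z * Num.sqrt (level s / bend s)) / level s.
  apply: cst; rewrite /= ?r0 ?s0//; first exact: between_convex.
  by move=> t /andP[t0 tr]; exact: scale_invariant.
have X : Num.sqrt (bend r / level r) * z * Num.sqrt (level r / bend r) = z.
  by rewrite (inv r r0 rr) mulrAC (divff q0) mul1r.
move=> e; apply: (ratio_eq (lt0r_neq0 d0)).
apply: etrans (esym (congr1 (fun t => profile r t / level r) X)) _.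
apply: etrans e _; apply: (congr1 (fun t => profile s t / level s)).
by congr (_ * _); exact: inv.
Qed.

(** ** The Riemannian case *)

(** The metric is read off from the fundamental tensor at the fixed vector
    [e1], which makes it smooth in [x] even on the axis; the formula for [F]
    extends to the axis and to vectors along [e0] by density. *)
Lemma riemannian_of_quadratic :
  (forall r, 0 < r -> r < rho -> exists a c, forall z, profile r z = a + c * z ^+ 2) ->
  is_riemannian rho F.
Proof.
move=> quad.
pose a x := fundamental_tensor (F x) e1.
have e1n0 : e1 != 0 by apply: space_neq0; rewrite -sradius_gt0 sradiusE e1_e1 sqrtr1.
have oC : open (cylinder rho : set E) := @open_cylinder R n rho.
have ca k A B : Ck k (cylinder rho) (fun x => a x A B).
  apply: (@Ck_affine R (E * E)%type E k S (cylinder rho) (fun x => (x, e1))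
    (fun w => (w, 0)) (fun p => fundamental_tensor (F p.1) p.2 A B)) => //.
  - by move=> h w z; congr pair; rewrite /= scaler0 add0r.
  - exact: Ck_fundamental_tensor.
exists a; split=> [A B|x cx].
  by apply: (proj2 (smooth_onP (cylinder rho) (fun x => a x A B))).
have Sx : S (x, e1) by [].
split.
- apply/matrixP => A B; rewrite mxE.
  exact: (fundamental_tensor_sym hF B A Sx).
- by have [_ _ _] := hF.2 x cx; exact.
move=> y.
have [F0 _ Fhom _] := hF.2 x cx.
suff <- : energy F x y = quad_form (a x) y by rewrite /energy sqrtr_sqr ger0_norm.
have [->|y0] := eqVneq y 0.
  have Fx0 : F x 0 = 0.
    by have := Fhom 2 0 (ltr0Sn _ 1); rewrite scaler0; move: (F x 0) => f fE; lra.
  rewrite /energy Fx0 expr0n /quad_form big1// => A _; rewrite big1// => B _.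
  by rewrite !mxE mulr0.
apply/eqP; rewrite -subr_eq0; apply/eqP.
have Sxy : S (x, y) by [].
apply: (@slit_density (fun p => on_pairs (energy F) p - quad_form (a p.1) p.2) (x, y)) => //.
  apply: (Ck_continuous (k := 0) (U := S)) => //.
  apply: CkB => //; first exact: Ck_energy.
  apply: Ck_sum => // A _; apply: Ck_sum => // B _.
  apply: CkM => //; last exact: Ck_y_coord.
  apply: CkM => //; last exact: Ck_y_coord.
  apply: (@Ck_affine R E (E * E)%type 0 (cylinder rho) S fst fst (fun x => a x A B)) => //.
  - by move=> p; apply: linear_differentiable => q; exact: cvg_fst.
  - by move=> p [].
move=> {x cx y y0 Sx Sxy F0 Fhom} x y [/= cx y0] x0 s0.
have r0 := sradius_x_gt0 x0; have rr := sradius_x_lt cx.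
have [u [c pE]] := quad _ r0 rr.
have p1E := derive1_quadratic pE.
have p2E z : derive1 (derive1 (profile (sradius x))) z = 2 * c.
  rewrite (funext p1E) derive1E; apply: derive_val.
  apply: (is_derive_eq (is_derive_cmulf (is_derive_idR z) (2 * c))).
  by rewrite mulr1.
have e1s : space_part e1 != 0 by rewrite -sradius_gt0 sradiusE e1_e1 sqrtr1.
apply/eqP; rewrite subr_eq0; apply/eqP; rewrite /on_pairs /= energy_profile// quad_form_hess//.
rewrite /energy_hess time_unitS mul0r /mixed /transverse p2E !p1E !pE -(sradius_sq y).
have := sradius_y_neq0 s0; move: (sradius y) (time_part y) => b t b0.
by field; rewrite b0 (gt_eqF (_ : 0 < sradius e1)) ?sradius_gt0.
Qed.

(** ** The product case *)

(** With [bend] constant, the similarity of the profiles only rescales the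
    spatial variable, by [1 / h] with [h ^+ 2 = bend / level]. *)
Lemma product_of_bend : (0 < rho) ->
  (forall r s, 0 < r -> r < rho -> 0 < s -> s < rho -> bend r = bend s) ->
  exists h G : R -> R,
    [/\ forall r : R, 0 < r -> r < rho -> 0 < h r,
        forall t : R, 0 < G t,
        forall t : R, derivable G t 1 /\ derivable (derive1 G) t 1,
        forall t : R, 0 < G t - t * derive1 G t /\ 0 < derive1 (derive1 G) t &
        forall x y : E, cylinder rho x -> space_part x != 0 -> space_part y != 0 ->
          F x y = sradius y * (h (sradius x))^-1 * G (h (sradius x) * slope y)].
Proof.
move=> rho0 bendE.
pose r1 := rho / 2.
have r10 : 0 < r1 by rewrite divr_gt0.
have r1r : r1 < rho by rewrite gtr_pMr// invf_lt1// ltr1n.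
pose h r := Num.sqrt (bend r / level r).
have h0 r : 0 < r -> r < rho -> 0 < h r.
  move=> r0 rr; rewrite sqrtr_gt0.
  exact: (divr_gt0 (profile2_gt0 0 r0 rr) (level_gt0 r0 rr)).
have h10 := h0 _ r10 r1r; have h1n := lt0r_neq0 h10.
pose P := profile r1.
have sP := smooth_profile r10 r1r; have sP1 := smooth_derive1 sP.
have P0 z : 0 < P z.
  exact: (profile_gt0 (fun z => profile2_gt0 z r10 r1r)
    (fun z => planar_det_gt0 z r10 r1r)).
have Ps0 z : 0 < Num.sqrt (P z) by rewrite sqrtr_gt0.
have PsE z : Num.sqrt (P z) ^+ 2 = P z by rewrite sqr_sqrtr// ltW.
pose G t := h r1 * Num.sqrt (P (t / h r1)).
have dlin t : is_derive t (1 : R) (fun t => t / h r1) (h r1)^-1.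
  apply: (is_derive_eq (is_derive_mulf (is_derive_idR t)
    (is_derive_cstf t (1 : R) (h r1)^-1))).
  by rewrite mulr0 mulr1 add0r.
have dPs t : is_derive t (1 : R) (fun t => Num.sqrt (P (t / h r1)))
    ((2 * Num.sqrt (P (t / h r1)))^-1 * (derive1 P (t / h r1) * (h r1)^-1)).
  exact: (is_derive_chain (is_derive_chain (dlin t) (smooth_is_derive1 _ sP))
    (is_derive1_sqrt (P0 _))).
have dG t : is_derive t (1 : R) G (derive1 P (t / h r1) / (2 * Num.sqrt (P (t / h r1)))).
  apply: (is_derive_eq (is_derive_cmulf (dPs t) (h r1))).
  have := lt0r_neq0 (Ps0 (t / h r1)).
  move: (Num.sqrt (P (t / h r1))) (derive1 P (t / h r1)) => s p1 s0.
  by move: (h r1) h1n => k k0; field; rewrite k0 s0.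
have G1 : derive1 G = fun t => derive1 P (t / h r1) / (2 * Num.sqrt (P (t / h r1))).
  by apply/funext => t; rewrite derive1E; exact: derive_val.
have dG1 t : is_derive t (1 : R) (derive1 G)
    (planar_det P (t / h r1) / (4 * h r1 * Num.sqrt (P (t / h r1)) ^+ 3)).
  rewrite G1.
  have n0 : 2 * Num.sqrt (P (t / h r1)) != 0 by rewrite mulf_neq0 ?pnatr_eq0// gt_eqF.
  apply: (is_derive_eq (is_derive_divf
    (is_derive_chain (dlin t) (smooth_is_derive1 _ sP1)) (is_derive_cmulf (dPs t) 2) n0)).
  have -> : planar_det P (t / h r1) = 2 * Num.sqrt (P (t / h r1)) ^+ 2 *
      derive1 (derive1 P) (t / h r1) - derive1 P (t / h r1) ^+ 2 by rewrite PsE.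
  have := lt0r_neq0 (Ps0 (t / h r1)).
  move: (derive1 (derive1 P) (t / h r1)) => p2.
  move: (Num.sqrt (P (t / h r1))) (derive1 P (t / h r1)) => s p1 s0.
  by move: (h r1) h1n => k k0; field; rewrite k0 s0.
exists h, G; split=> //.
- by move=> t; rewrite mulr_gt0.
- move=> t; split.
    have -> : G t - t * derive1 G t =
        h r1 * transverse P (t / h r1) / (2 * Num.sqrt (P (t / h r1))).
      have -> : transverse P (t / h r1) = 2 * Num.sqrt (P (t / h r1)) ^+ 2 -
          t / h r1 * derive1 P (t / h r1) by rewrite PsE.
      rewrite G1 /G.
      have := lt0r_neq0 (Ps0 (t / h r1)).
      move: (Num.sqrt (P (t / h r1))) (derive1 P (t / h r1)) => s p1 s0.
      by move: (h r1) h1n => k k0; field; rewrite k0 s0.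
    have M0 := transverse_gt0 (t / h r1) r10 r1r.
    exact: (divr_gt0 (mulr_gt0 h10 M0) (mulr_gt0 (ltr0Sn R 1) (Ps0 _))).
  rewrite derive1E (@derive_val _ _ _ _ _ _ _ (dG1 t)).
  exact: (divr_gt0 (planar_det_gt0 _ r10 r1r)
    (mulr_gt0 (mulr_gt0 (ltr0Sn R 3) h10) (exprn_gt0 3 (Ps0 _)))).
move=> x y cx x0 y0.
have r0 := sradius_x_gt0 x0; have rr := sradius_x_lt cx.
have Fge0 : 0 <= F x y by have [F0 _ _ _] := hF.2 x cx.
rewrite -[F x y]ger0_norm// -sqrtr_sqr -/(energy F x y) energy_profile//.
rewrite sqrtrM ?sqr_ge0// sqrtr_sqr ger0_norm ?sradius_ge0// -mulrA; congr (_ * _).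
rewrite (profile_similar (slope y) r0 rr r10 r1r) /G -/P -/(h (sradius x)) -/(h r1).
have dr := level_gt0 r0 rr; have d1 := level_gt0 r10 r1r.
have c1 := profile2_gt0 0 r10 r1r; have cr := profile2_gt0 0 r0 rr.
rewrite (sqrtrM _ (ltW (divr_gt0 dr d1))) [RHS]mulrA; congr (_ * _).
have hr := h0 _ r0 rr.
have -> : level (sradius x) / level r1 = ((h (sradius x))^-1 * h r1) ^+ 2.
  rewrite exprMn exprVn /h (sqr_sqrtr (ltW (divr_gt0 c1 d1))).
  rewrite (sqr_sqrtr (ltW (divr_gt0 cr dr))) (bendE _ _ r0 rr r10 r1r).
  move: (bend r1) (level r1) (level (sradius x)) c1 d1 dr.
  move=> c {}d1 {}dr /lt0r_neq0 c0 /lt0r_neq0 d10 /lt0r_neq0 dr0.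
  by field; rewrite dr0 d10 c0.
rewrite sqrtr_sqr; apply: ger0_norm; apply: ltW.
by apply: mulr_gt0 => //; rewrite invr_gt0.
Qed.

(** A non-zero [l] at one radius makes the norm there Euclidean, and similarity
    carries this to all radii; otherwise [bend] is constant. *)
Lemma classification : 0 < rho ->
  is_riemannian rho F \/
  exists h G : R -> R,
    [/\ forall r : R, 0 < r -> r < rho -> 0 < h r,
        forall t : R, 0 < G t,
        forall t : R, derivable G t 1 /\ derivable (derive1 G) t 1,
        forall t : R, 0 < G t - t * derive1 G t /\ 0 < derive1 (derive1 G) t &
        forall x y : E, cylinder rho x -> space_part x != 0 -> space_part y != 0 ->
          F x y = sradius y * (h (sradius x))^-1 * G (h (sradius x) * slope y)].
Proof.
move=> rho0.
have [[s [l [v [s0 sr lv l0]]]]|hl] :=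
    pselect (exists s l v, [/\ 0 < s, s < rho, linear_at s l v & l != 0]).
  left; apply: riemannian_of_quadratic => r r0 rr.
  have m0 z : mixed (profile s) z = 0.
    by have [_ _ /(_ z)/eqP] := lv; rewrite mulf_eq0 (negbTE l0) => /eqP.
  have [a [c [_ pE _]]] := mixed0_profile s0 sr m0.
  pose k := Num.sqrt (bend r / level r) / Num.sqrt (bend s / level s).
  exists (level r / level s * a), (level r / level s * c * k ^+ 2) => z.
  apply: etrans (profile_similar z r0 rr s0 sr) _; rewrite (pE (_ / _)) /k.
  by move: (Num.sqrt _) (Num.sqrt _)^-1 (level r / level s) => s1 s2 w; ring.
right; apply: (product_of_bend rho0) => r s r0 rr s0 sr.
apply: (@derive0_cst R [set t : R | 0 < t < rho] (fun t => bend t)) => /=; rewrite ?r0 ?s0//.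
  exact: between_convex.
move=> t /andP[t0 tr]; have [l [v lv]] := rates_linear t0 tr.
have l0 : l = 0.
  by apply/eqP; rewrite -[_ == _]negbK; apply/negP => l0; apply: hl; exists t, l, v.
apply: (is_derive_eq (is_derive_bend t0 tr lv)).
by rewrite l0 mulr0 mul0r.
Qed.

End Classification.

End RadialEnergy.

Theorem corollary2 (R : realType) (n : nat) (hn : (2 <= n)%N)
  (rho : R) (hrho : 0 < rho)
  (F : 'rV[R]_n.+1 -> 'rV[R]_n.+1 -> R) (phi : R -> R -> R)
  (hphi : forall z r : R, 0 < r -> r < rho ->
     differentiable (fun p : R * R => phi p.1 p.2) (z, r))
  (hF : finsler_metric rho F)
  (hFphi : forall x y : 'rV[R]_n.+1, cylinder rho x ->
     space_part x != 0 -> space_part y != 0 ->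
     F x y = enorm (space_part y) *
       Num.sqrt (phi (time_part y / enorm (space_part y))
                     (enorm (space_part x)))) :
  (is_berwald rho F <-> is_landsberg rho F) /\
  (is_berwald rho F ->
     is_riemannian rho F \/
     exists h G : R -> R,
       [/\ forall r : R, 0 < r -> r < rho -> 0 < h r,
           forall t : R, 0 < G t,
           forall t : R, derivable G t 1 /\ derivable (derive1 G) t 1,
           forall t : R, 0 < G t - t * derive1 G t /\ 0 < derive1 (derive1 G) t &
           forall x y : 'rV[R]_n.+1, cylinder rho x ->
             space_part x != 0 -> space_part y != 0 ->
             F x y = enorm (space_part y) * (h (enorm (space_part x)))^-1 *
               G (h (enorm (space_part x)) *
                  (time_part y / enorm (space_part y)))]).
Proof.
pose i1 : 'I_n := Ordinal (ltnW hn); pose i2 : 'I_n := Ordinal hn.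
have i12 : i1 != i2 by [].
have radial (x y : 'rV[R]_n.+1) : cylinder rho x ->
    space_part x != 0 -> space_part y != 0 ->
    F x y = sradius y * F (sradius x *: unit_vec R (lift ord0 i1))
      ((time_part y / sradius y) *: unit_vec R ord0 + unit_vec R (lift ord0 i2)).
  move=> cx x0 y0; have r0 : 0 < sradius x by rewrite sradius_gt0.
  have re := sradius_e1 i1 r0; have be := sradius_point i2 (time_part y / sradius y).
  have hF' (u w : 'rV[R]_n.+1) : cylinder rho u -> space_part u != 0 ->
      space_part w != 0 -> F u w =
      sradius w * Num.sqrt (phi (time_part w / sradius w) (sradius u)) by exact: hFphi.
  rewrite (hF' x y cx x0 y0) hF'; first last.
  - exact: space_point.
  - by rewrite -sradius_gt0 re.
  - by have : sradius (sradius x *: unit_vec R (lift ord0 i1)) < rho by rewrite re.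
  by rewrite re be mul1r divr1 !time_units mulr1 addr0.
have BL := @berwald_landsberg R n rho F.
have LB := landsberg_berwald i12 hF radial.
split; first by split.
move=> /BL hL; apply: (classification i12 hF radial _ hrho) => r r0 rr.
exact: (landsberg_linear i12 hF radial hL r0 rr).
Qed.
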